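(* Define $W(\delta)$ to be the density function for real eigenvalues of matrices in $\mathcal{M}_2([-1,1])$: if $M$ is a randomly chosen matrix from $\mathcal{M}_2([-1,1])$, then the expected number of (real) eigenvalues of $M$ in the interval $[s,t]$ is $\int_s^t W(\delta)\, d\delta$. Then $W(-\delta)=W(\delta)$ and \[ W(\delta) = \begin{cases} \dfrac{80 + 20\delta + 90\delta^2 + 52\delta^3 - 107\delta^4}{144(1+\delta)} - \dfrac{(5-7\delta+8\delta^2)(1-\delta)}{12} \log(1-\delta) - \dfrac{\delta(1-\delta^2)}{4} \log(1+\delta), & \text{if } 0 \le \delta \le 1,\\[2ex] \dfrac{\delta(20+10\delta-12\delta^2-3\delta^3)}{16(1+\delta)} + \dfrac{(3\delta-1)(\delta-1)}{4}\log(\delta-1) + \dfrac{\delta (\delta^2-1)}{4} \log(\delta+1), & \text{if } 1 \le \delta \le \sqrt{2},\\[2ex] \dfrac{\delta(\delta-2)(2-6\delta+3\delta^2)}{16(\delta-1)} - \dfrac{(\delta-1)^3}{4} \log(\delta-1), & \text{if } \sqrt{2} \le \delta \le 2, \\[2ex] 0, & \text{if } \delta\ge2. \end{cases} \]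
   Context: $\mathcal{M}_2([-1,1])$ denotes the probability space of $2\times2$ real matrices whose four entries are independent random variables, each uniformly distributed on the interval $[-1,1]$. Here $\log$ is the natural logarithm. At $\delta=1$ the expressions are interpreted by continuity (so that $0\cdot\log 0=0$), giving $W(1)=15/32$. As usual for densities, the value of $W$ at individual points (more generally, on a null set) is immaterial. *)

(* Defs.v *)
From mathcomp Require Export all_boot all_order all_algebra finmap.
From mathcomp Require Export all_classical all_reals all_analysis.
Export Order.TTheory GRing.Theory Num.Theory numFieldNormedType.Exports.

Set Implicit Arguments.
Unset Strict Implicit.
Unset Printing Implicit Defensive.

Local Open Scope classical_set_scope.
Local Open Scope ring_scope.

Definition mutually_independent (R : realType) (d : measure_display)
    (T : measurableType d) (P : probability T R) (I : finType)
    (X : I -> {RV P >-> R}) : Prop :=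
  forall (J : {set I}) (A : I -> set R), (forall i, measurable (A i)) ->
    P (\bigcap_(i in [set` J]) X i @^-1` A i) =
    (\prod_(i in J) P (X i @^-1` A i))%E.

Lemma ltN1_1 (R : realType) : -1 < 1 :> R.
Proof. by rewrite gtrN. Qed.

(* Equality of measures is asserted on measurable sets only: as functions on  *)
(* all sets, both sides take meaningless values outside the sigma-algebra.    *)
Definition uniform_m1_1 (R : realType) (d : measure_display)
    (T : measurableType d) (P : probability T R) (X : {RV P >-> R}) : Prop :=
  forall A : set R, measurable A ->
    distribution P X A = uniform_prob (ltN1_1 R) A.

(* A random element of M_2([-1,1]), given by its entries X (i, j) on an       *)
(* arbitrary probability space.                                               *)
Definition uniform_entries (R : realType) (d : measure_display)
    (T : measurableType d) (P : probability T R)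
    (X : 'I_2 * 'I_2 -> {RV P >-> R}) : Prop :=
  mutually_independent X /\ forall ij, uniform_m1_1 (X ij).

Definition random_mx (R : realType) (d : measure_display)
    (T : measurableType d) (P : probability T R)
    (X : 'I_2 * 'I_2 -> {RV P >-> R}) (w : T) : 'M[R]_2 :=
  \matrix_(i < 2, j < 2) X (i, j) w.

(* Eigenvalues are counted without multiplicity; this affects only matrices   *)
(* with a double eigenvalue, which have probability 0 in M_2([-1,1]).         *)
Definition num_eigenvalues (R : realType) (n : nat) (M : 'M[R]_n) (s t : R) :
    nat :=
  #|` fset_set [set x : R | eigenvalue M x /\ s <= x <= t] |.

(* The expectations are finite and the extended-real integral is -oo when     *)
(* both the positive and the negative part have integral +oo, so the equation *)
(* forces W to be locally integrable.                                         *)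
Definition eigenvalue_density (R : realType) (d : measure_display)
    (T : measurableType d) (P : probability T R)
    (X : 'I_2 * 'I_2 -> {RV P >-> R}) (W : R -> R) : Prop :=
  measurable_fun [set: R] W /\
  forall s t : R, s <= t ->
    ('E_P[fun w => ((num_eigenvalues (random_mx X w) s t)%:R : R)%R] =
     \int[lebesgue_measure]_(x in `[s, t]) (W x)%:E)%E.

(* At x = 1 the terms with ln 0 are multiplied by 0, as the convention        *)
(* 0 * log 0 = 0 requires.                                                    *)
Definition W_formula (R : realType) (x : R) : R :=
  if x <= 1 then
    (80 + 20 * x + 90 * x ^+ 2 + 52 * x ^+ 3 - 107 * x ^+ 4)
      / (144 * (1 + x))
    - (5 - 7 * x + 8 * x ^+ 2) * (1 - x) / 12 * ln (1 - x)
    - x * (1 - x ^+ 2) / 4 * ln (1 + x)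
  else if x <= Num.sqrt 2 then
    x * (20 + 10 * x - 12 * x ^+ 2 - 3 * x ^+ 3) / (16 * (1 + x))
    + (3 * x - 1) * (x - 1) / 4 * ln (x - 1)
    + x * (x ^+ 2 - 1) / 4 * ln (x + 1)
  else if x <= 2 then
    x * (x - 2) * (2 - 6 * x + 3 * x ^+ 2) / (16 * (x - 1))
    - (x - 1) ^+ 3 / 4 * ln (x - 1)
  else 0.

(* Main.v *)
Require Import Defs.
From mathcomp Require Import ring lra measurable_realfun.

(** Fix the diagonal entries a, e and the entry b of the matrix. A real x is an
    eigenvalue iff c = (x - a) (x - e) / b, so the area formula for this
    quadratic function of x turns the integral over c of the number of
    eigenvalues in [s, t] into the integral over x in [s, t] of
    |2 x - a - e| / |b| restricted to |(x - a) (x - e)| <= |b|. Integrating over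
    b produces kappa (x - a) (x - e), where
    kappa u v = |u + v| max(0, - ln |u v|), and by Tonelli the density at x is
    1/8 of the integral of kappa over the square [x - 1, x + 1]^2. Cutting the
    square along the axes, the antidiagonal and the hyperbola u v = 1 leaves
    pieces with elementary primitives; for x >= 0 the shape of the pieces
    changes when a side of the square crosses an axis (x = 1) and when one of
    the corners (x - 1, x + 1) and (x - 1, x - 1) crosses the hyperbola
    (x = sqrt 2 and x = 2). The density is unique almost everywhere by the
    Lebesgue differentiation theorem. *)

Set Implicit Arguments.
Unset Strict Implicit.
Unset Printing Implicit Defensive.

Local Open Scope classical_set_scope.
Local Open Scope ring_scope.

(** * Integrals on the real line *)

Section one_variable.
Context {R : realType}.
Implicit Types (f F : R -> R) (a b k x y : R).
Local Notation mu := (@lebesgue_measure R).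

Lemma is_derive_continuous F x df : is_derive x 1 F df -> {for x, continuous F}.
Proof.
move=> [dF _]; apply: differentiable_continuous.
by rewrite -derivable1_diffP.
Qed.

Lemma continuous_measurable_oo f a b :
  {in `]a, b[, continuous f} -> measurable_fun `]a, b[ f.
Proof.
move=> cf; apply: open_continuous_measurable_fun => // x /set_mem; exact: cf.
Qed.

(** The integrand may blow up logarithmically at the ends, so only [F] is continuous on the closed
    interval. The usual theorem applies on compact subintervals; monotone convergence on the
    integrals and continuity of [F] at the ends give the limit. *)
Lemma ge0_FTC_oo f F a b : a < b ->
  {within `[a, b], continuous F} ->
  {in `]a, b[, continuous f} ->
  {in `]a, b[, forall x, 0 <= f x} ->
  {in `]a, b[, forall x, is_derive x 1 F (f x)} ->
  (\int[mu]_(x in `[a, b]) (f x)%:E = (F b - F a)%:E)%E.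
Proof.
move=> ab cF cf f0 dF.
have mf : measurable_fun `]a, b[ f by exact: continuous_measurable_oo.
rewrite (@integral_itv_bndoo _ _ _ _ true false)//; last exact/measurable_EFinP.
pose e (n : nat) := (b - a) / 3 * harmonic n.
have e0 n : 0 < e n by rewrite mulr_gt0 ?invr_gt0 ?ltr0n// divr_gt0// subr_gt0.
have eD n : e n <= (b - a) / 3.
  rewrite ler_piMr//; first by rewrite divr_ge0// subr_ge0 ltW.
  by rewrite invf_le1// ler1n.
have ecvg : e n @[n --> \oo] --> 0.
  rewrite -[0](mulr0 ((b - a) / 3)); apply: cvgM; first exact: cvg_cst.
  exact: cvg_harmonic.
have end_e m n : (m <= n)%N -> e n <= e m.
  move=> mn; rewrite ler_wpM2l ?divr_ge0 ?subr_ge0 ?(ltW ab)//.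
  by rewrite lef_pV2 ?posrE ?ltr0n// ler_nat ltnS.
move: e e0 eD ecvg end_e => e e0 eD ecvg end_e.
pose I n := `[a + e n, b - e n]%classic.
have Isub n : I n `<=` `]a, b[.
  rewrite /I => x /=; rewrite !in_itv/= => /andP[h1 h2]; have := e0 n => h.
  apply/andP; split; lra.
have UI : `]a, b[%classic = \bigcup_n I n.
  apply/seteqP; split => [x/=|x [n _]]; last exact: Isub.
  rewrite in_itv/= => /andP[ax xb].
  have xd : 0 < Num.min (x - a) (b - x) by rewrite lt_min !subr_gt0 ax xb.
  have : \forall n \near \oo, e n < Num.min (x - a) (b - x).
    by apply: (cvgr_lt 0).
  move=> [n _ /(_ n (leqnn n))]; rewrite lt_min => /andP[h1 h2].
  by exists n => //; rewrite /I/= in_itv/=; apply/andP; split; lra.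
have [cFi cFa cFb] := (continuous_within_itvP _ ab).1 cF.
have In n :
  (\int[mu]_(x in I n) (f x)%:E = (F (b - e n))%:E - (F (a + e n))%:E)%E.
  have abn : a + e n < b - e n by have := eD n; have := e0 n; lra.
  have inab x : x \in `]a + e n, b - e n[ -> x \in `]a, b[.
    rewrite !in_itv/= => /andP[h1 h2]; have := e0 n => h.
    by apply/andP; split; lra.
  apply: (@continuous_FTC2 _ f F) => //.
  - apply: continuous_in_subspaceT => x /set_mem/Isub; exact: cf.
  - split.
    + by move=> x /inab xab; have [] := dF _ xab.
    + apply: cvg_at_right_filter; apply: cFi; apply: (@Isub n).
      by rewrite /I/= in_itv/= lexx ltW.
    + apply: cvg_at_left_filter; apply: cFi; apply: (@Isub n).
      by rewrite /I/= in_itv/= lexx andbT ltW.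
  - by move=> x /inab xab; rewrite derive1E; apply: derive_val; exact: dF.
have lim1 : (\int[mu]_(x in I n) (f x)%:E)%E @[n --> \oo] -->
    (\int[mu]_(x in \bigcup_n I n) (f x)%:E)%E.
  apply: ge0_nondecreasing_set_cvg_integral => //.
  - move=> m n mn; apply/subsetPset; rewrite /I => x /=;
      rewrite !in_itv/= => /andP[h1 h2].
    by have h := end_e _ _ mn; apply/andP; split; lra.
  - by move=> n; exact: measurable_itv.
  - move=> n; apply/measurable_EFinP; apply: measurable_funS mf => //.
  - by move=> n x /Isub; rewrite lee_fin; exact: f0.
have lim2 : (\int[mu]_(x in I n) (f x)%:E)%E @[n --> \oo] --> (F b - F a)%:E.
  under eq_fun do rewrite In -EFinB.
  apply: cvg_EFin; first by near=> n.
  apply: cvgB.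
    move/cvg_at_leftP: cFb; apply; split.
      by move=> n; have := e0 n; lra.
    by rewrite -[X in _ --> X]subr0; apply: cvgB => //; exact: cvg_cst.
  move/cvg_at_rightP: cFa; apply; split.
    by move=> n; have := e0 n; lra.
  by rewrite -[X in _ --> X]addr0; apply: cvgD => //; exact: cvg_cst.
rewrite UI; apply: (cvg_unique _ lim1 lim2).
Unshelve. all: by end_near. Qed.

(** Lebesgue measure is determined by its values on half-open intervals; a reflection moves the open
    end to the other side but keeps the length. *)
Lemma lebesgue_measure_reflect k (A : set R) : measurable A ->
  pushforward mu (fun x => k - x : measurableTypeR R) A = mu A.
Proof.
pose g (x : measurableTypeR R) : measurableTypeR R := k - x.
have mg : measurable_fun setT g by exact: measurable_funB.
pose m0 : {measure set (measurableTypeR R) -> \bar R} := pushforward mu g.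
move=> mA; apply/esym.
rewrite (@lebesgue_measure_unique _ (m0 mg))// => _ [[u v]] _ <-.
rewrite /= /pushforward (_ : g @^-1` _ = `[k - v, k - u[%classic).
  rewrite !lebesgue_measure_itv/= !lte_fin ltrD2l ltrN2; case: ifPn => // _.
  by rewrite -!EFinD; congr EFin; ring.
by apply/seteqP; split => x; rewrite /g/= !in_itv/=; lra.
Qed.

Lemma ge0_integral_reflect k (f : R -> \bar R) :
  measurable_fun setT f -> (forall x, 0 <= f x)%E ->
  (\int[mu]_x f (k - x)%R = \int[mu]_x f x)%E.
Proof.
move=> mf f0.
pose g (x : measurableTypeR R) : measurableTypeR R := k - x.
have mg : measurable_fun setT g by exact: measurable_funB.
transitivity (\int[mu]_(x in g @^-1` setT) (f \o g) x)%E => //.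
rewrite -(ge0_integral_pushforward mg)//.
by apply: eq_measure_integral => A mA _; exact: lebesgue_measure_reflect.
Qed.

(** A shift is the composite of the reflections [x -> - x] and [x -> k - x]. *)
Lemma ge0_integral_shift k (f : R -> \bar R) :
  measurable_fun setT f -> (forall x, 0 <= f x)%E ->
  (\int[mu]_x f (k + x)%R = \int[mu]_x f x)%E.
Proof.
move=> mf f0.
rewrite -[RHS](ge0_integral_reflect k)// -[RHS](ge0_integral_reflect 0)//=.
  by under [RHS]eq_integral do rewrite sub0r opprK.
by apply: measurableT_comp => //; exact: measurable_funB.
Qed.
End one_variable.

(** * Integrals over closed intervals: primitives, cutting and reflection *)

Section interval_integrals.
Context {R : realType}.
Implicit Types (x y u v a b c k : R) (f F : R -> R) (g : R -> \bar R).
Local Notation mu := (@lebesgue_measure R).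

Lemma derivable_continuous_oo f a b :
  (forall x, a < x < b -> derivable f x 1) -> {in `]a, b[, continuous f}.
Proof.
move=> df x; rewrite in_itv/= => /df fx; apply: differentiable_continuous.
by rewrite -derivable1_diffP.
Qed.

(** Meant for integrands, such as inner integrals or [kappa] itself, whose closed form [f] is known
    only inside the interval; the end points do not contribute. *)
Lemma ge0_FTC_oo_ext g f F a b : a < b ->
  {within `[a, b], continuous F} ->
  {in `]a, b[, continuous f} ->
  {in `]a, b[, forall x, 0 <= f x} ->
  {in `]a, b[, forall x, is_derive x 1 F (f x)} ->
  {in `]a, b[, forall x, g x = (f x)%:E} ->
  (\int[mu]_(x in `[a, b]) g x = (F b - F a)%:E)%E.
Proof.
move=> ab cF cf f0 dF gf.
rewrite -(ge0_FTC_oo ab cF cf f0 dF).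
have mf : measurable_fun (`]a, b[ : set (measurableTypeR R))
    (fun x => (f x)%:E).
  by apply/measurable_EFinP; exact: continuous_measurable_oo.
have mg : measurable_fun (`]a, b[ : set (measurableTypeR R)) g.
  apply: (eq_measurable_fun (fun x => (f x)%:E)) mf => x /set_mem xab.
  by rewrite gf.
rewrite (@integral_itv_bndoo _ _ _ g true false)//.
rewrite (@integral_itv_bndoo _ _ _ (fun x => (f x)%:E) true false)//.
by apply: eq_integral => x /set_mem; exact: gf.
Qed.

Lemma ge0_integral_itvD g a c b : a <= c <= b ->
  measurable_fun setT g -> (forall x, 0 <= g x)%E ->
  (\int[mu]_(x in `[a, b]) g x =
   \int[mu]_(x in `[a, c]) g x + \int[mu]_(x in `[c, b]) g x)%E.
Proof.
move=> /andP[ac cb] mg g0.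
have -> : `[a, b]%classic = (`[a, c] `|` `]c, b])%classic.
  by rewrite -itv_bndbnd_setU// bnd_simp.
rewrite ge0_integral_setU//=.
- congr (_ + _)%E; apply: integral_itv_obnd_cbnd.
  exact: measurable_funTS.
- exact: measurable_funTS.
- apply/disj_setPS => x [] /=; rewrite !in_itv/= => /andP[_ xc] /andP[cx _].
  lra.
Qed.

Lemma ge0_integral_itv_reflect k g a b :
  measurable_fun setT g -> (forall x, 0 <= g x)%E ->
  (\int[mu]_(x in `[a, b]) g (k - x)%R =
   \int[mu]_(x in `[(k - b)%R, (k - a)%R]) g x)%E.
Proof.
move=> mg g0.
rewrite [RHS]integral_mkcond/= -(ge0_integral_reflect k); last 2 first.
- by apply/(measurable_restrictT g) => //; exact: measurable_funTS.
- by move=> x; apply: erestrict_ge0.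
rewrite integral_mkcond/=; apply: eq_integral => x _; rewrite !patchE !mem_setE.
by rewrite !in_itv/=; congr (if _ then _ else _); apply/idP/idP; lra.
Qed.

Lemma ge0_integral_itvN g a b :
  measurable_fun setT g -> (forall x, 0 <= g x)%E ->
  (\int[mu]_(x in `[(- b)%R, (- a)%R]) g x =
   \int[mu]_(x in `[a, b]) g (- x)%R)%E.
Proof.
move=> mg g0.
have := ge0_integral_itv_reflect 0 a b mg g0; rewrite !sub0r => <-.
by apply: eq_integral => x _; rewrite sub0r.
Qed.
End interval_integrals.

(** * Integrals of the kernel over rectangles *)

Section log_primitives.
Context {R : realType}.
Implicit Types (x y u v a b : R).

(** For n = 1, 2, 3 these are the primitives of - x^(n-1) ln x on x > 0 that vanish at 0. *)
Definition lnI1 x := x - x * ln x.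
Definition lnI2 x := x ^+ 2 / 4 - x ^+ 2 / 2 * ln x.
Definition lnI3 x := x ^+ 3 / 9 - x ^+ 3 / 3 * ln x.

(** Since [ln] is 0 on nonpositive reals, only x = 0 is delicate. With s = sqrt y, the bound - ln s
    < 1 / s gives |y ln y| <= 2 s for small y > 0. *)
Lemma continuous_xln : continuous (fun x => x * ln x : R).
Proof.
move=> x; have [x0|x0|->] := ltgtP x 0.
- rewrite /continuous_at (ln0 (ltW x0)) mulr0.
  apply: cvg_near_cst; near=> y; rewrite ln0 ?mulr0//; apply: ltW; near: y.
  exact: lt_nbhsl.
- by apply: cvgM; [exact: cvg_id|exact: continuous_ln].
- rewrite /continuous_at mul0r; apply/norm_cvg0P.
  apply: (@squeeze_cvgr _ _ _ _ (cst 0) (fun y => 2 * Num.sqrt `|y|)).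
  + near=> y; rewrite normr_ge0/=.
    have [y0|y0] := leP y 0;
      first by rewrite ln0// mulr0 normr0 mulr_ge0// sqrtr_ge0.
    have y1 : y < 1 by near: y; exact: lt_nbhsl.
    have s0 : 0 < Num.sqrt y by rewrite sqrtr_gt0.
    have yE : y = Num.sqrt y ^+ 2 by rewrite sqr_sqrtr// ltW.
    rewrite normrM !(gtr0_norm y0) ler0_norm; last exact/ln_le0/ltW.
    have h : - ln (Num.sqrt y) < (Num.sqrt y)^-1.
      by rewrite -lnV ?posrE//; apply: ln_sublinear; rewrite invr_gt0.
    have lE : ln y = 2 * ln (Num.sqrt y) by rewrite [in LHS]yE lnXn// mulr_natl.
    have h2 : Num.sqrt y * - ln (Num.sqrt y) <= 1.
      by rewrite mulrC -ler_pdivlMr// mul1r ltW.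
    have h3 := ler_wpM2l (ltW s0) h2.
    rewrite lE; move: (Num.sqrt y) yE h3 => s -> h3; lra.
  + exact: cvg_cst.
  + rewrite -[X in _ --> X](mulr0 2); apply: cvgM; first exact: cvg_cst.
    rewrite -[X in _ --> X](@sqrtr0 R) -[X in Num.sqrt X](@normr0 _ R).
    apply: continuous_comp; last exact: sqrt_continuous.
    exact: norm_continuous.
Unshelve. all: by end_near. Qed.

Lemma is_derive_lnI1 x : 0 < x -> is_derive x 1 lnI1 (- ln x).
Proof.
move=> x0; have dl := is_derive1_ln x0.
rewrite /lnI1; apply: is_derive_eq.
rewrite /GRing.scale /=; field; lra.
Qed.

Lemma is_derive_lnI2 x : 0 < x -> is_derive x 1 lnI2 (- (x * ln x)).
Proof.
move=> x0; have dl := is_derive1_ln x0.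
rewrite /lnI2; apply: is_derive_eq.
rewrite /GRing.scale /=; field; lra.
Qed.

Lemma is_derive_lnI3 x : 0 < x -> is_derive x 1 lnI3 (- (x ^+ 2 * ln x)).
Proof.
move=> x0; have dl := is_derive1_ln x0.
rewrite /lnI3; apply: is_derive_eq.
rewrite /GRing.scale /=; field; lra.
Qed.

End log_primitives.

(** * The kernel [kappa] and its integrals over rectangles with a corner at the origin *)

Section kappa.
Context {R : realType}.
Implicit Types (x y u v a b c k : R).
Local Notation mu := (@lebesgue_measure R).

Definition kappa u v := `|u + v| * Num.max 0 (- ln `|u * v|).

Lemma kappa_ge0 u v : 0 <= kappa u v.
Proof. by apply: mulr_ge0 => //; rewrite le_max lexx. Qed.

Lemma kappaC u v : kappa u v = kappa v u.
Proof. by rewrite /kappa [u + v]addrC [u * v]mulrC. Qed.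

Lemma kappaN u v : kappa (- u) (- v) = kappa u v.
Proof. by rewrite /kappa -opprD normrN mulrNN. Qed.

Lemma kappaNr u v : kappa u (- v) = `|u - v| * Num.max 0 (- ln `|u * v|).
Proof. by rewrite /kappa mulrN normrN. Qed.

Lemma max_lnM u v : 0 < u -> 0 < v -> u * v <= 1 ->
  Num.max 0 (- ln `|u * v|) = - ln u - ln v.
Proof.
move=> u0 v0 uv; rewrite gtr0_norm ?mulr_gt0// max_r ?oppr_ge0 ?ln_le0//.
by rewrite lnM ?posrE// opprD.
Qed.

Lemma kappa_pos u v : 0 < u -> 0 < v -> u * v <= 1 ->
  kappa u v = (u + v) * (- ln u - ln v).
Proof. by move=> u0 v0 uv; rewrite /kappa max_lnM// gtr0_norm// addr_gt0. Qed.

Lemma kappa_eq0 u v : 1 <= `|u * v| -> kappa u v = 0.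
Proof.
by move=> uv; rewrite /kappa max_l ?mulr0// oppr_le0 ln_ge0.
Qed.

Lemma measurable_kappa d (T : measurableType d) (f g : T -> R) :
  measurable_fun setT f -> measurable_fun setT g ->
  measurable_fun setT (fun t => (kappa (f t) (g t))%:E).
Proof.
move=> mf mg; apply/measurable_EFinP; apply: measurable_funM.
  by apply: measurableT_comp => //; exact: measurable_funD.
apply: measurable_maxr => //; apply: measurable_funN.
apply: (measurableT_comp (@measurable_ln R)).
by apply: measurableT_comp => //; exact: measurable_funM.
Qed.

(* Primitives of kappa where |u v| <= 1: kappa_prim1 in v, then kappa_prim2 in
   u, on the quadrant u, v > 0; the N versions serve the quadrant v < 0 < u,
   where the sign of u + v changes on the antidiagonal. *)
Definition kappa_prim1 u y := (u * y + y ^+ 2 / 2) * - ln u + u * lnI1 y + lnI2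
  y.

Definition kappa_prim2 x y :=
  lnI2 x * y + x ^+ 2 / 2 * lnI1 y + y ^+ 2 / 2 * lnI1 x + x * lnI2 y.

Definition kappaN_prim1 u y := (u * y - y ^+ 2 / 2) * - ln u + u * lnI1 y - lnI2
  y.

Definition kappaN_prim2 x y := 2 * (x ^+ 3 / 4 + lnI3 x)
  - (y * lnI2 x - y ^+ 2 / 2 * lnI1 x + x ^+ 2 / 2 * lnI1 y - x * lnI2 y).

Lemma continuous_lnI1 : continuous (@lnI1 R).
Proof.
move=> x; apply: cvgB; first exact: cvg_id.
exact: continuous_xln.
Qed.

Lemma continuous_lnI2 : continuous (@lnI2 R).
Proof.
have -> : @lnI2 R = (fun x => x ^+ 2 / 4 - x / 2 * (x * ln x)).
  by apply/funext => x; rewrite /lnI2; field.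
move=> x; apply: cvgB; last apply: cvgM; last exact: continuous_xln.
  by apply: cvgM; [exact: exprn_continuous|exact: cvg_cst].
by apply: cvgM; [exact: cvg_id|exact: cvg_cst].
Qed.

Lemma continuous_lnI3 : continuous (@lnI3 R).
Proof.
have -> : @lnI3 R = (fun x => x ^+ 3 / 9 - x ^+ 2 / 3 * (x * ln x)).
  by apply/funext => x; rewrite /lnI3; field.
move=> x; apply: cvgB; last apply: cvgM; last exact: continuous_xln.
  by apply: cvgM; [exact: exprn_continuous|exact: cvg_cst].
by apply: cvgM; [exact: exprn_continuous|exact: cvg_cst].
Qed.

Lemma lnI10 : lnI1 0 = 0 :> R.
Proof. by rewrite /lnI1 mul0r subr0. Qed.
Lemma lnI20 : lnI2 0 = 0 :> R.
Proof. by rewrite /lnI2 expr0n/= !mul0r subr0. Qed.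
Lemma lnI30 : lnI3 0 = 0 :> R.
Proof. by rewrite /lnI3 expr0n/= !mul0r subr0. Qed.

Lemma is_derive_kappa_prim1 u y : 0 < y ->
  is_derive y 1 (kappa_prim1 u) ((u + y) * (- ln u - ln y)).
Proof.
move=> y0; have d1 := is_derive_lnI1 y0; have d2 := is_derive_lnI2 y0.
rewrite /kappa_prim1; apply: is_derive_eq. rewrite /GRing.scale/=; by field.
Qed.

Lemma is_derive_kappaN_prim1 u y : 0 < y ->
  is_derive y 1 (kappaN_prim1 u) ((u - y) * (- ln u - ln y)).
Proof.
move=> y0; have d1 := is_derive_lnI1 y0; have d2 := is_derive_lnI2 y0.
rewrite /kappaN_prim1; apply: is_derive_eq; rewrite /GRing.scale/=; by field.
Qed.

Lemma is_derive_kappa_prim2 x y : 0 < x -> is_derive x 1 (kappa_prim2 ^~ y)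
  (kappa_prim1 x y).
Proof.
move=> x0; have d1 := is_derive_lnI1 x0; have d2 := is_derive_lnI2 x0.
rewrite /kappa_prim2 /kappa_prim1; apply: is_derive_eq; rewrite /GRing.scale/=;
  by field.
Qed.

(** On the diagonal, [kappaN_prim1 x x] collapses to 3/4 x^2 - x^2 ln x, with primitive x^3 / 4 +
    [lnI3 x]; this is where the cubic terms come from. *)
Lemma is_derive_kappaN_prim2 x y : 0 < x ->
  is_derive x 1 (kappaN_prim2 ^~ y) (2 * kappaN_prim1 x x - kappaN_prim1 x y).
Proof.
move=> x0; have d1 := is_derive_lnI1 x0; have d2 := is_derive_lnI2 x0.
have d3 := is_derive_lnI3 x0.
rewrite /kappaN_prim2 /kappaN_prim1; apply: is_derive_eq;
  rewrite /GRing.scale/=.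
by rewrite /lnI1 /lnI2; field.
Qed.

Lemma continuous_kappa_prim1 u : continuous (kappa_prim1 u).
Proof.
move=> y; apply: cvgD; last exact: continuous_lnI2.
apply: cvgD; apply: cvgM;
  [|exact: cvg_cst|exact: cvg_cst|exact: continuous_lnI1].
apply: cvgD; apply: cvgM;
  [exact: cvg_cst|exact: cvg_id|exact: exprn_continuous|exact: cvg_cst].
Qed.

Lemma continuous_kappaN_prim1 u : continuous (kappaN_prim1 u).
Proof.
move=> y; apply: cvgB; last exact: continuous_lnI2.
apply: cvgD; apply: cvgM;
  [|exact: cvg_cst|exact: cvg_cst|exact: continuous_lnI1].
apply: cvgB; apply: cvgM;
  [exact: cvg_cst|exact: cvg_id|exact: exprn_continuous|exact: cvg_cst].
Qed.

Lemma continuous_kappa_prim2 y : continuous (kappa_prim2 ^~ y).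
Proof.
move=> x; apply: cvgD; last first.
  by apply: cvgM; [exact: cvg_id|exact: cvg_cst].
apply: cvgD; last by apply: cvgM; [exact: cvg_cst|exact: continuous_lnI1].
apply: cvgD; apply: cvgM;
  [exact: continuous_lnI2|exact: cvg_cst| |exact: cvg_cst].
by apply: cvgM; [exact: exprn_continuous|exact: cvg_cst].
Qed.

Lemma continuous_kappaN_prim2 y : continuous (kappaN_prim2 ^~ y).
Proof.
move=> x; apply: cvgB.
  apply: cvgM; [exact: cvg_cst|apply: cvgD; last exact: continuous_lnI3].
  by apply: cvgM; [exact: exprn_continuous|exact: cvg_cst].
apply: cvgB; last by apply: cvgM; [exact: cvg_id|exact: cvg_cst].
apply: cvgD; last first.
  apply: cvgM; last exact: cvg_cst.
  by apply: cvgM; [exact: exprn_continuous|exact: cvg_cst].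
apply: cvgB; apply: cvgM; [exact: cvg_cst|exact: continuous_lnI2|
  exact: cvg_cst|exact: continuous_lnI1].
Qed.

Lemma integral_kappa_pos u y : 0 < u -> 0 < y -> u * y <= 1 ->
  (\int[mu]_(v in `[0%R, y]) (kappa u v)%:E = (kappa_prim1 u y)%:E)%E.
Proof.
move=> u0 y0 uy.
have lt1 v : v \in `]0, y[ -> 0 < v /\ u * v <= 1.
  by rewrite in_itv/= => /andP[v0 vy]; split => //; nra.
rewrite (@ge0_FTC_oo_ext _ _ (fun v => (u + v) * (- ln u - ln v))
  (kappa_prim1 u)).
- by rewrite /kappa_prim1 lnI10 lnI20; congr EFin; ring.
- by [].
- by apply: continuous_subspaceT; exact: continuous_kappa_prim1.
- apply: derivable_continuous_oo => v /andP[v0 _].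
  by have := is_derive1_ln v0 => ?; exact: ex_derive.
- move=> v /lt1[v0 uv]; rewrite -kappa_pos//; exact: kappa_ge0.
- by move=> v /lt1[v0 uv]; exact: is_derive_kappa_prim1.
- by move=> v /lt1[v0 uv]; rewrite kappa_pos.
Qed.

(** The kernel vanishes beyond the hyperbola, so the value is [kappa_prim1 u] at v = 1 / u, where
    the logarithms cancel and [y] disappears. *)
Lemma integral_kappa_pos_ge u y : 0 < u -> 0 < y -> 1 <= u * y ->
  (\int[mu]_(v in `[0%R, y]) (kappa u v)%:E = (1 + (4 * u ^+ 2)^-1)%:E)%E.
Proof.
move=> u0 y0 uy; have iu : u^-1 <= y by rewrite -div1r ler_pdivrMr// mulrC.
have iu0 : 0 < u^-1 by rewrite invr_gt0.
have iuy : 0 <= u^-1 <= y by rewrite iu ltW.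
rewrite (ge0_integral_itvD iuy); last 2 first.
- exact: measurable_kappa.
- by move=> v; rewrite lee_fin kappa_ge0.
rewrite integral_kappa_pos ?mulfV ?gt_eqF//.
rewrite [X in (_ + X)%E](_ : _ = 0%E); last first.
  apply: integral0_eq => v /=; rewrite in_itv/= => /andP[uv vy].
  rewrite kappa_eq0// ger0_norm;
    last by rewrite mulr_ge0// ltW// (lt_le_trans iu0).
  by rewrite mulrC -ler_pdivrMr// div1r.
rewrite adde0; congr EFin; rewrite /kappa_prim1 /lnI1 /lnI2 lnV ?posrE//.
by field; rewrite gt_eqF.
Qed.

(** The factor u - v changes sign at v = u, so the integral is (p u - p 0) - (p y - p u) with p =
    [kappaN_prim1 u] and p 0 = 0. *)
Lemma integral_kappa_neg u y : 0 < u -> u <= y -> u * y <= 1 ->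
  (\int[mu]_(v in `[0%R, y]) (kappa u (- v))%:E =
   (2 * kappaN_prim1 u u - kappaN_prim1 u y)%:E)%E.
Proof.
move=> u0 uy uy1.
have cont v : 0 < v -> derivable (fun v => (u - v) * (- ln u - ln v)) v 1.
  by move=> v0; have := is_derive1_ln v0 => ?; exact: ex_derive.
have u0y : 0 <= u <= y by rewrite uy ltW.
rewrite (ge0_integral_itvD u0y); last 2 first.
- by apply: measurable_kappa => //; exact: measurable_funN.
- by move=> v; rewrite lee_fin kappa_ge0.
have E1 : (\int[mu]_(v in `[0%R, u]) (kappa u (- v))%:E =
    (kappaN_prim1 u u - kappaN_prim1 u 0)%:E)%E.
  have kE v : v \in `]0, u[ -> kappa u (- v) = (u - v) * (- ln u - ln v).
    rewrite in_itv/= => /andP[v0 vu].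
    by rewrite kappaNr max_lnM//; [rewrite ger0_norm//; lra|nra].
  apply: (@ge0_FTC_oo_ext _ _ (fun v => (u - v) * (- ln u - ln v))
    (kappaN_prim1 u)).
  - by [].
  - by apply: continuous_subspaceT; exact: continuous_kappaN_prim1.
  - by apply: derivable_continuous_oo => v /andP[v0 _]; exact: cont.
  - by move=> v vu; rewrite -kE//; exact: kappa_ge0.
  - by move=> v; rewrite in_itv/= => /andP[v0 vu];
      exact: is_derive_kappaN_prim1.
  - by move=> v vu; rewrite kE.
rewrite E1; have [uy'|yu] := ltP u y; last first.
  have -> : y = u by apply/eqP; rewrite eq_le yu uy.
  rewrite set_itv1 integral_set1 adde0 /kappaN_prim1 lnI10 lnI20.
  by congr EFin; ring.
have kE v : v \in `]u, y[ -> kappa u (- v) = - ((u - v) * (- ln u - ln v)).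
  rewrite in_itv/= => /andP[uv vy].
  rewrite kappaNr max_lnM//; [|lra|nra].
  by rewrite ler0_norm ?mulNr//; lra.
rewrite (@ge0_FTC_oo_ext _ _ (fun v => - ((u - v) * (- ln u - ln v)))
  (fun v => - kappaN_prim1 u v)).
- by rewrite -EFinD /kappaN_prim1 lnI10 lnI20; congr EFin; ring.
- by [].
- by apply: continuous_subspaceT => v; apply: cvgN;
    exact: continuous_kappaN_prim1.
- apply: derivable_continuous_oo => v /andP[uv _].
  by apply: derivableN; apply: cont; exact: lt_trans uv.
- by move=> v vu; rewrite -kE//; exact: kappa_ge0.
- move=> v; rewrite in_itv/= => /andP[v0 vu].
  by apply: is_deriveN; apply: is_derive_kappaN_prim1; lra.
- by move=> v vu; rewrite kE.
Qed.

Lemma integral2_kappa_pos x y : 0 < x -> 0 < y -> x * y <= 1 ->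
  (\int[mu]_(u in `[0%R, x]) \int[mu]_(v in `[0%R, y]) (kappa u v)%:E =
   (kappa_prim2 x y)%:E)%E.
Proof.
move=> x0 y0 xy.
have lt1 u : u \in `]0, x[ -> 0 < u /\ u * y <= 1.
  by rewrite in_itv/= => /andP[u0 ux]; split => //; nra.
rewrite (@ge0_FTC_oo_ext _ _ (kappa_prim1 ^~ y) (kappa_prim2 ^~ y)).
- by rewrite /kappa_prim2 lnI10 lnI20; congr EFin; ring.
- by [].
- by apply: continuous_subspaceT; exact: continuous_kappa_prim2.
- apply: derivable_continuous_oo => u /andP[u0 _].
  by have := is_derive1_ln u0 => ?; rewrite /kappa_prim1; exact: ex_derive.
- move=> u /lt1[u0 uy]; rewrite -lee_fin -integral_kappa_pos//.
  by apply: integral_ge0 => v _; rewrite lee_fin kappa_ge0.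
- by move=> u /lt1[u0 uy]; exact: is_derive_kappa_prim2.
- by move=> u /lt1[u0 uy]; exact: integral_kappa_pos.
Qed.

(** As x <= y, the sign change v = u lies in [0, y] for every u in [0, x], so one formula for the
    inner integral serves throughout. *)
Lemma integral2_kappa_neg x y : 0 < x -> x <= y -> x * y <= 1 ->
  (\int[mu]_(u in `[0%R, x]) \int[mu]_(v in `[0%R, y]) (kappa u (- v))%:E =
   (kappaN_prim2 x y)%:E)%E.
Proof.
move=> x0 xy xy1.
have lt1 u : u \in `]0, x[ -> [/\ 0 < u, u <= y & u * y <= 1].
  by rewrite in_itv/= => /andP[u0 ux]; split; [|lra|nra].
rewrite (@ge0_FTC_oo_ext _ _ (fun u => 2 * kappaN_prim1 u u - kappaN_prim1 u y)
  (kappaN_prim2 ^~ y)).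
- by rewrite /kappaN_prim2 lnI10 lnI20 lnI30; congr EFin; ring.
- by [].
- by apply: continuous_subspaceT; exact: continuous_kappaN_prim2.
- apply: derivable_continuous_oo => u /andP[u0 _].
  have d1 := is_derive_lnI1 u0; have d2 := is_derive_lnI2 u0.
  by have := is_derive1_ln u0 => ?; rewrite /kappaN_prim1; exact: ex_derive.
- move=> u /lt1[u0 uy uy1]; rewrite -lee_fin -integral_kappa_neg//.
  by apply: integral_ge0 => v _; rewrite lee_fin kappa_ge0.
- by move=> u /lt1[u0 uy uy1]; exact: is_derive_kappaN_prim2.
- by move=> u /lt1[u0 uy uy1]; exact: integral_kappa_neg.
Qed.

(** With the range of [v] encoded by an indicator, this is a section integral of a nonnegative
    measurable function on the plane, and Tonelli gives measurability. *)
Lemma measurable_integral_kappa a b :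
  measurable_fun setT (fun u => \int[mu]_(v in `[a, b]) (kappa u v)%:E)%E.
Proof.
pose f (z : measurableTypeR R * measurableTypeR R) :=
  ((kappa z.1 z.2)%:E * (\1_(`[a, b] : set R) z.2)%:E)%E.
have mf : measurable_fun setT f.
  apply: emeasurable_funM; first exact: measurable_kappa.
  by apply/measurable_EFinP; apply: measurableT_comp => //;
    exact: measurable_indic.
rewrite (_ : (fun _ => _) = fubini_F mu f).
  apply: measurable_fun_fubini_tonelli_F => // z.
  by rewrite mule_ge0// lee_fin ?kappa_ge0// indicE.
apply/funext => u; rewrite integral_mkcond; apply: eq_integral => v _.
rewrite patchE /f/= indicE; case: ifPn => _; first by rewrite mule1.
by rewrite mule0.
Qed.

(** Cut at u = 1 / y. To the left the rectangle lies under the hyperbola; to the right the inner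
    integral is 1 + 1 / (4 u^2), with primitive u - 1 / (4 u). *)
Lemma integral2_kappa_pos_ge x y : 0 < x -> 0 < y -> 1 <= x * y ->
  (\int[mu]_(u in `[0%R, x]) \int[mu]_(v in `[0%R, y]) (kappa u v)%:E =
   (kappa_prim2 y^-1 y + (x - y^-1) + (y - x^-1) / 4)%:E)%E.
Proof.
move=> x0 y0 xy; have iy : y^-1 <= x by rewrite -div1r ler_pdivrMr.
have iy0 : 0 < y^-1 by rewrite invr_gt0.
have iyx : 0 <= y^-1 <= x by rewrite iy ltW.
rewrite (ge0_integral_itvD iyx); last 2 first.
- exact: measurable_integral_kappa.
- by move=> u; apply: integral_ge0 => v _; rewrite lee_fin kappa_ge0.
rewrite integral2_kappa_pos ?mulVf ?gt_eqF//.
have [yx|xy'] := ltP y^-1 x; last first.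
  have -> : x = y^-1 by apply/eqP; rewrite eq_le xy' iy.
  by rewrite set_itv1 integral_set1 adde0 invrK; congr EFin; ring.
have lt1 u : u \in `]y^-1, x[ -> 0 < u /\ 1 <= u * y.
  rewrite in_itv/= => /andP[yu ux]; split; first exact: lt_trans yu.
  by rewrite -ler_pdivrMr// div1r ltW.
have dF u : 0 < u ->
    is_derive u 1 (fun u : R => u - 4^-1 * u^-1) (1 + (4 * u ^+ 2)^-1).
  move=> u0; have un0 : u != 0 by rewrite gt_eqF.
  have dV := @is_deriveV R id u 1 1 un0 (is_derive_id u 1).
  by apply: is_derive_eq; rewrite /GRing.scale/=; field.
rewrite (@ge0_FTC_oo_ext _ _ (fun u => 1 + (4 * u ^+ 2)^-1)
  (fun u => u - 4^-1 * u^-1)).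
- by rewrite -EFinD; congr EFin; field; rewrite !gt_eqF.
- by [].
- apply: continuous_in_subspaceT => u /set_mem/=;
    rewrite in_itv/= => /andP[yu _].
  by apply: is_derive_continuous (dF u _); exact: lt_le_trans yu.
- move=> u /lt1[u0 _]; apply: cvgD; first exact: cvg_cst.
  apply: cvgV; first by rewrite mulf_neq0// expf_neq0// gt_eqF.
  by apply: cvgM; [exact: cvg_cst|exact: exprn_continuous].
- move=> u /lt1[u0 _]; rewrite addr_ge0// invr_ge0 mulr_ge0// exprn_ge0// ltW//.
- by move=> u /lt1[u0 _]; exact: dF.
- by move=> u /lt1[u0 uy]; exact: integral_kappa_pos_ge.
Qed.
End kappa.

(** * The integral of [kappa] over the square centred at (x, x) *)

Section kappa_rectangles.
Context {R : realType}.
Implicit Types (x y u v a b c k : R).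
Local Notation mu := (@lebesgue_measure R).

Definition kappa_rect a b c d :=
  (\int[mu]_(u in `[a, b]) \int[mu]_(v in `[c, d]) (kappa u v)%:E)%E.

Lemma kappa_rect_ge0 a b c d : (0 <= kappa_rect a b c d)%E.
Proof.
by apply: integral_ge0 => u _; apply: integral_ge0 => v _;
  rewrite lee_fin kappa_ge0.
Qed.

Lemma kappa_rectC a b c d : kappa_rect a b c d = kappa_rect c d a b.
Proof.
pose f (z : measurableTypeR R * measurableTypeR R) :=
  ((kappa z.1 z.2)%:E *
    ((\1_(`[a, b] : set R) z.1)%:E * (\1_(`[c, d] : set R) z.2)%:E))%E.
have mf : measurable_fun setT f.
  apply: emeasurable_funM; first exact: measurable_kappa.
  by apply: emeasurable_funM; apply/measurable_EFinP;
    apply: measurableT_comp => //;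
    exact: measurable_indic.
have f0 z : (0 <= f z)%E.
  by rewrite !mule_ge0// lee_fin ?kappa_ge0// indicE.
transitivity (\int[mu]_u \int[mu]_v f (u, v))%E.
  rewrite /kappa_rect integral_mkcond; apply: eq_integral => u _.
  rewrite patchE /f/= [in RHS]indicE; case: ifPn => _.
    rewrite integral_mkcond; apply: eq_integral => v _.
    rewrite patchE indicE mul1e; case: ifPn => _; first by rewrite mule1.
    by rewrite mule0.
  by rewrite integral0_eq// => v _; rewrite mul0e mule0.
transitivity (\int[mu]_v \int[mu]_u f (u, v))%E; first exact: fubini_tonelli.
symmetry.
rewrite /kappa_rect integral_mkcond; apply: eq_integral => v _.
rewrite patchE /f/= [in RHS]indicE; case: ifPn => _.
  rewrite integral_mkcond; apply: eq_integral => u _.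
  rewrite patchE indicE mule1 kappaC; case: ifPn => _; first by rewrite mule1.
  by rewrite mule0.
by rewrite integral0_eq// => u _; rewrite !mule0.
Qed.

Lemma kappa_rectD e a b c d : a <= e <= b ->
  (kappa_rect a b c d = kappa_rect a e c d + kappa_rect e b c d)%E.
Proof.
move=> aeb; apply: ge0_integral_itvD => //.
- exact: measurable_integral_kappa.
- by move=> u; apply: integral_ge0 => v _; rewrite lee_fin kappa_ge0.
Qed.

Lemma integral_kappaN u a b :
  (\int[mu]_(v in `[(- b)%R, (- a)%R]) (kappa u v)%:E =
   \int[mu]_(v in `[a, b]) (kappa u (- v))%:E)%E.
Proof.
apply: (@ge0_integral_itvN _ (fun v => (kappa u v)%:E)).
- exact: measurable_kappa.
- by move=> v; rewrite lee_fin kappa_ge0.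
Qed.

Lemma kappa_rectN a b c d :
  kappa_rect (- b) (- a) (- d) (- c) = kappa_rect a b c d.
Proof.
transitivity
  (\int[mu]_(u in `[a, b]) \int[mu]_(v in `[(- d)%R, (- c)%R])
    (kappa (- u) v)%:E)%E.
  apply: (@ge0_integral_itvN _
    (fun u => \int[mu]_(v in `[(- d)%R, (- c)%R]) (kappa u v)%:E)%E).
  - exact: measurable_integral_kappa.
  - by move=> u; apply: integral_ge0 => v _; rewrite lee_fin kappa_ge0.
apply: eq_integral => u _; rewrite integral_kappaN.
by apply: eq_integral => v _; rewrite kappaN.
Qed.

Definition kappa_square x := kappa_rect (x - 1) (x + 1) (x - 1) (x + 1).

Lemma kappa_squareN x : kappa_square (- x) = kappa_square x.
Proof.
by rewrite /kappa_square -[RHS]kappa_rectN !opprD !opprK.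
Qed.

(** The axes cut the square into four pieces. The two mixed ones are equal by symmetry and lie
    within |u v| <= 1 because (1 - x) (1 + x) <= 1; the negative one reflects to a square under the
    hyperbola; only the positive one crosses it. *)
Lemma kappa_square_lt1 x : 0 < x < 1 ->
  kappa_square x = (8 * W_formula x)%:E.
Proof.
move=> /andP[x0 x1]; rewrite /kappa_square.
have [a0 b0 ab0] : [/\ 0 < 1 - x, 0 < x + 1 & (1 - x) * (x + 1) <= 1].
  by split; [lra|lra|nra].
have -> : x - 1 = - (1 - x) by ring.
have h : - (1 - x) <= 0 <= x + 1 by lra.
(* [kappa_rectD] cuts the first range only; the second is cut after exchanging the two by
   [kappa_rectC]. *)
rewrite (kappa_rectD _ _ h) [X in (X + _)%E]kappa_rectC (kappa_rectD _ _ h).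
rewrite [X in (_ + X)%E]kappa_rectC (kappa_rectD _ _ h).
rewrite [kappa_rect 0 _ (- _) _]kappa_rectC.
have -> : kappa_rect (- (1 - x)) 0 (- (1 - x)) 0 =
  (kappa_prim2 (1 - x) (1 - x))%:E.
  have := kappa_rectN 0 (1 - x) 0 (1 - x); rewrite !oppr0 => ->.
  by apply: integral2_kappa_pos => //; nra.
have -> : kappa_rect (- (1 - x)) 0 0 (x + 1) =
  (kappaN_prim2 (1 - x) (x + 1))%:E.
  have := kappa_rectN 0 (1 - x) (- (x + 1)) 0; rewrite !oppr0 opprK => ->.
  have ab : 1 - x <= x + 1 by lra.
  rewrite -(integral2_kappa_neg a0 ab ab0).
  by apply: eq_integral => u _; have := integral_kappaN u 0 (x + 1);
    rewrite oppr0.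
rewrite [kappa_rect 0 _ 0 _]integral2_kappa_pos_ge//; last nra.
rewrite -!EFinD; congr EFin.
rewrite /W_formula (ltW x1) /kappa_prim2 /kappaN_prim2 /lnI1 /lnI2 /lnI3 lnV
  ?posrE//.
by rewrite [1 + x]addrC; field; lra.
Qed.

(* Inclusion-exclusion, as kappa is symmetric; finiteness of the three given
   integrals makes the subtraction legitimate. *)
Lemma kappa_rect_corner a b p q r : 0 <= a <= b ->
  kappa_rect 0 a 0 a = p%:E -> kappa_rect 0 a 0 b = q%:E ->
  kappa_rect 0 b 0 b = r%:E -> kappa_rect a b a b = (r - 2 * q + p)%:E.
Proof.
move=> ab pE qE rE.
have addEFinI (x y : R) (z : \bar R) : (x%:E + z = y%:E)%E -> z = (y - x)%:E.
  by case: z => // z [<-]; congr EFin; ring.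
have h1 : kappa_rect a b 0 a = (q - p)%:E.
  by apply: addEFinI; rewrite -pE -(kappa_rectD _ _ ab) kappa_rectC.
have h2 : kappa_rect a b 0 b = (r - q)%:E.
  by apply: addEFinI; rewrite -qE -(kappa_rectD _ _ ab).
have -> : r - 2 * q + p = (r - q) - (q - p) by ring.
by apply: addEFinI;
  rewrite -h1 -h2 kappa_rectC -(kappa_rectD _ _ ab) kappa_rectC.
Qed.

(** The square now lies in the positive quadrant. Of the three rectangles at the origin that express
    it, only the largest crosses the hyperbola, as x^2 - 1 < 1. *)
Lemma kappa_square_gt1 x : 1 < x -> x ^+ 2 < 2 ->
  kappa_square x = (8 * W_formula x)%:E.
Proof.
move=> x1 x2; rewrite /kappa_square.
have [a0 b0 ab] : [/\ 0 < x - 1, 0 < x + 1 & 0 <= x - 1 <= x + 1] by split; lra.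
have aa : (x - 1) * (x - 1) <= 1 by nra.
have bb : 1 <= (x + 1) * (x + 1) by nra.
have ab1 : (x - 1) * (x + 1) <= 1 by nra.
rewrite (kappa_rect_corner ab (integral2_kappa_pos a0 a0 aa)
  (integral2_kappa_pos a0 b0 ab1) (integral2_kappa_pos_ge b0 b0 bb)).
congr EFin; rewrite /W_formula leNgt x1/=.
have -> : x <= Num.sqrt 2.
  by rewrite -[x]ger0_norm ?(ltW (lt_trans _ x1))// -sqrtr_sqr ler_sqrt// ltW.
rewrite /kappa_prim2 /lnI1 /lnI2 lnV ?posrE//.
by rewrite [1 + x]addrC; field; lra.
Qed.

(** Here x^2 - 1 > 1, so the mixed rectangle crosses the hyperbola as well, while (x - 1)^2 < 1
    keeps the small square under it. *)
Lemma kappa_square_gt_sqrt2 x : 2 < x ^+ 2 -> 0 < x < 2 ->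
  kappa_square x = (8 * W_formula x)%:E.
Proof.
move=> x2 /andP[x0 x2']; rewrite /kappa_square.
have x1 : 1 < x by nra.
have [a0 b0 ab] : [/\ 0 < x - 1, 0 < x + 1 & 0 <= x - 1 <= x + 1] by split; lra.
have aa : (x - 1) * (x - 1) <= 1 by nra.
have bb : 1 <= (x + 1) * (x + 1) by nra.
have ab1 : 1 <= (x - 1) * (x + 1) by nra.
rewrite (kappa_rect_corner ab (integral2_kappa_pos a0 a0 aa)
  (integral2_kappa_pos_ge a0 b0 ab1) (integral2_kappa_pos_ge b0 b0 bb)).
congr EFin; rewrite /W_formula leNgt x1/= (ltW x2').
have -> : (x <= Num.sqrt 2) = false.
  apply/negbTE; rewrite -ltNge -[x]ger0_norm ?(ltW x0)// -sqrtr_sqr ltr_sqrt//.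
  exact: lt_trans x2.
rewrite /kappa_prim2 /lnI1 /lnI2 lnV ?posrE//.
by field; lra.
Qed.

Lemma kappa_square_gt2 x : 2 < x -> kappa_square x = (8 * W_formula x)%:E.
Proof.
move=> x2; rewrite /W_formula.
have -> : (x <= 1) = false by apply/negbTE; rewrite -ltNge; lra.
have -> : (x <= 2) = false by apply/negbTE; rewrite -ltNge.
have -> : (x <= Num.sqrt 2) = false.
  have h : 2 < x ^+ 2 by nra.
  apply/negbTE; rewrite -ltNge -[x]ger0_norm ?(ltW (lt_trans _ x2))//.
  rewrite -sqrtr_sqr ltr_sqrt//.
  exact: lt_trans h.
rewrite mulr0; apply: integral0_eq => u; rewrite /= in_itv/= => /andP[xu _].
apply: integral0_eq => v; rewrite /= in_itv/= => /andP[xv _].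
by rewrite kappa_eq0// ger0_norm; nra.
Qed.

(** The cases are computed for strict inequalities only; what they leave out is this finite set,
    which is null. *)
Definition breakpoints : seq R :=
  [:: 0; 1; -1; Num.sqrt 2; - Num.sqrt 2; 2; -2].

Lemma kappa_squareE x : x \notin breakpoints ->
  kappa_square x = (8 * W_formula `|x|)%:E.
Proof.
rewrite !inE !negb_or => /andP[x0 /andP[x1 /andP[xN1 /andP[xs /andP[xNs]]]]].
move=> /andP[x2 xN2].
have -> : kappa_square x = kappa_square `|x|.
  by have [_|_] := ger0P x; rewrite ?kappa_squareN.
have y0 : 0 < `|x| by rewrite normr_gt0.
have y1 : `|x| != 1 by rewrite eqr_norml negb_and negb_or x1 xN1.
have y2 : `|x| != 2 by rewrite eqr_norml negb_and negb_or x2 xN2.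
have ys : `|x| ^+ 2 != 2.
  have -> : 2 = Num.sqrt 2 ^+ 2 :> R by rewrite sqr_sqrtr.
  by rewrite real_normK ?num_real// eqf_sqr negb_or xs xNs.
move: (`|x|) y0 y1 y2 ys => y y0 y1 y2 ys.
have [|y1'|y1'] := ltgtP y 1; last by rewrite y1' eqxx in y1.
  by move=> ?; apply: kappa_square_lt1; rewrite y0.
have [ys'|ys'|ys'] := ltgtP (y ^+ 2) 2; last by rewrite ys' eqxx in ys.
  exact: kappa_square_gt1.
have [y2'|y2'|y2'] := ltgtP y 2; last by rewrite y2' eqxx in y2.
  by apply: kappa_square_gt_sqrt2 => //; rewrite y0.
exact: kappa_square_gt2.
Qed.

End kappa_rectangles.

(** * Counting the roots of a quadratic equation *)

Section area_formula.
Context {R : realType}.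
Implicit Types (x y u v a b c k p q s t m B Z : R).
Local Notation mu := (@lebesgue_measure R).

Lemma measurable_boolR d (T : measurableType d) (f : T -> bool) :
  measurable_fun setT f -> measurable_fun setT (fun t : T => (f t)%:R : R).
Proof.
move=> mf; rewrite (_ : (fun t : T => _) = (fun t : T => if f t then 1 else 0)).
  exact: measurable_fun_ifT.
by apply/funext => t; case: (f t).
Qed.

Lemma measurable_itvR d (T : measurableType d) (f : T -> R) p q :
  measurable_fun setT f -> measurable_fun setT (fun t : T => (p <= f t <= q)).
Proof.
by move=> mf; apply: measurable_and; exact: measurable_fun_ler.
Qed.

Lemma integral_itv_bool (g : R -> R) (a b : R) (P : R -> bool) :
  (forall x, P x = (a <= x <= b)) ->
  (\int[mu]_x ((P x)%:R * g x)%:E = \int[mu]_(x in `[a, b]) (g x)%:E)%E.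
Proof.
move=> PE; rewrite [RHS]integral_mkcond; apply: eq_integral => x _.
rewrite patchE mem_setE in_itv/= PE.
by case: ifPn => _; rewrite ?mul1r ?mul0r.
Qed.

Lemma integral_bool0 (g : R -> R) (P : R -> bool) : (forall x, P x = false) ->
  (\int[mu]_x ((P x)%:R * g x)%:E = 0)%E.
Proof. by move=> P0; apply: integral0_eq => x _; rewrite P0 mul0r. Qed.

(** The map [c -> Z + B * c] sends [-1, 1] onto [Z - B, Z + B], so the measure is the length of the
    overlap with [p, q] divided by B; the outer maximum covers an empty overlap. *)
Lemma integral_window B Z p q : 0 < B -> 
  (\int[mu]_(c in `[(-1)%R, 1%R]) ((p <= Z + B * c <= q)%R%:R : R)%:E =
   (Num.max 0 ((Num.min q (Z + B) - Num.max p (Z - B)) / B))%:E)%E.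
Proof.
move=> B0; set H := Num.min q _; set L := Num.max p _.
have Bn0 : B != 0 by rewrite gt_eqF.
transitivity (\int[mu]_x (((L - Z) / B <= x <= (H - Z) / B)%R%:R * 1)%:E)%E.
  rewrite integral_mkcond; apply: eq_integral => c _.
  rewrite patchE mem_setE in_itv/= mulr1.
  have -> : ((L - Z) / B <= c <= (H - Z) / B) =
      (-1 <= c <= 1) && (p <= Z + B * c <= q).
    rewrite ler_pdivrMr// ler_pdivlMr// lerBlDl lerBrDl /H /L ge_max le_min.
    rewrite [c * B]mulrC.
    have -> : Z - B <= Z + B * c = (-1 <= c).
      by rewrite lerD2l -[- B]mulrN1 ler_pM2l.
    have -> : Z + B * c <= Z + B = (c <= 1).
      by rewrite lerD2l -[X in _ <= X]mulr1 ler_pM2l.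
    by case: (p <= _); case: (-1 <= c); case: (c <= 1); rewrite ?andbT ?andbF.
  by case: ifPn.
rewrite (@integral_itv_bool _ ((L - Z) / B) ((H - Z) / B))//.
rewrite integral_cst//= mul1e lebesgue_measure_itv/= lte_fin.
have -> : (H - L) / B = (H - Z) / B - (L - Z) / B by field.
by case: ltP => h; [rewrite max_r// subr_ge0 ltW|rewrite max_l// subr_le0].
Qed.

(** The substitution y = x^2 turns the weight 2 x dx / B into dy / B. The value is that of
    [integral_window] for the window [p^2, q^2], which is the area formula on one monotone
    branch. *)
Lemma integral_sqr_window B Z p q : 0 < B -> 0 <= p <= q -> 0 <= Z ->
  (\int[mu]_x ((p <= x <= q)%R%:R *
     (2 * x / B * (`|x ^+ 2 - Z| <= B)%R%:R))%:E =
   (Num.max 0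
     ((Num.min (q ^+ 2) (Z + B) - Num.max (p ^+ 2) (Z - B)) / B))%:E)%E.
Proof.
move=> B0 /andP[p0 pq] Z0.
set H := Num.min (q ^+ 2) _; set L := Num.max (p ^+ 2) _.
have q0 : 0 <= q by exact: le_trans pq.
(* Nonnegativity of both ends makes [Num.sqrt L] and [Num.sqrt H] true square roots; for [H] it uses
   0 <= Z. *)
have L0 : 0 <= L by rewrite le_max sqr_ge0.
have H0 : 0 <= H by rewrite le_min sqr_ge0/=; lra.
transitivity
  (\int[mu]_x ((Num.sqrt L <= x <= Num.sqrt H)%R%:R * (2 * x / B))%:E)%E.
  apply: eq_integral => x _; congr EFin.
  rewrite mulrCA [RHS]mulrC; congr (_ * _).
  rewrite -natrM mulnb; congr (nat_of_bool _)%:R.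
  have [x0|x0] := ltP x 0.
    have -> : (p <= x) = false by apply/negbTE; rewrite -ltNge (lt_le_trans x0).
    have -> : (Num.sqrt L <= x) = false.
      by apply/negbTE; rewrite -ltNge (lt_le_trans x0)// sqrtr_ge0.
    by [].
  have sqE a : 0 <= a -> (a <= x) = (a ^+ 2 <= x ^+ 2).
    by move=> a0; rewrite ler_sqr.
  have sqE' a : 0 <= a -> (x <= a) = (x ^+ 2 <= a ^+ 2).
    by move=> a0; rewrite ler_sqr.
  rewrite !sqE ?sqE' ?sqrtr_ge0// !sqr_sqrtr// /H /L ge_max le_min.
  rewrite ler_norml.
  have -> : (- B <= x ^+ 2 - Z) = (Z - B <= x ^+ 2) by apply/idP/idP; lra.
  have -> : (x ^+ 2 - Z <= B) = (x ^+ 2 <= Z + B) by apply/idP/idP; lra.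
  by rewrite andbACA.
rewrite (@integral_itv_bool _ (Num.sqrt L) (Num.sqrt H))//.
have [LH|HL] := ltP L H; last first.
  rewrite max_l; last by rewrite pmulr_lle0 ?invr_gt0// subr_le0.
  have : Num.sqrt H <= Num.sqrt L by rewrite ler_sqrt.
  rewrite le_eqVlt => /predU1P[->|HL'].
    by rewrite set_itv1 integral_set1.
  by rewrite set_itv_ge ?integral_set0// bnd_simp -ltNge.
have LH' : Num.sqrt L < Num.sqrt H by rewrite ltr_sqrt// (le_lt_trans L0).
rewrite (@ge0_FTC_oo_ext _ _ (fun x => 2 * x / B) (fun x => x ^+ 2 / B) _ _
  LH').
- rewrite !sqr_sqrtr// -mulrBl max_r//.
  by apply: mulr_ge0; [rewrite subr_ge0|rewrite invr_ge0]; exact: ltW.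
- apply: continuous_subspaceT => x.
  by apply: cvgM; [exact: exprn_continuous|exact: cvg_cst].
- move=> x _; apply: cvgM; last exact: cvg_cst.
  by apply: cvgM; [exact: cvg_cst|exact: cvg_id].
- move=> x; rewrite in_itv/= => /andP[Lx _].
  have x0 : 0 <= x by apply: le_trans (ltW Lx); exact: sqrtr_ge0.
  by rewrite mulr_ge0 ?mulr_ge0// invr_ge0 ltW.
- by move=> x _; apply: is_derive_eq; rewrite /GRing.scale/=; ring.
- by [].
Qed.

(* For y < 0 both sides are false, although Num.sqrt y = 0. *)
Lemma sqrt_window y p q : 0 <= q ->
  (0 <= y) && (p <= Num.sqrt y <= q) = (Num.max p 0 ^+ 2 <= y <= q ^+ 2).
Proof.
move=> q0; have m0 : 0 <= Num.max p 0 by rewrite le_max lexx orbT.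
have [y0|y0] := ltP y 0.
  have -> // : (Num.max p 0 ^+ 2 <= y) = false.
  by apply/negbTE; rewrite -ltNge (lt_le_trans y0)// sqr_ge0.
rewrite /= -[in RHS](sqr_sqrtr y0) !ler_sqr ?nnegrE ?sqrtr_ge0//.
by rewrite ge_max sqrtr_ge0 andbT.
Qed.

(** Restricting to x >= 0 replaces [p] by [Num.max p 0]. If that exceeds [q] both sides vanish;
    otherwise both are the same window length. *)
Lemma integral_branch B Z p q : 0 < B -> 0 <= Z ->
  (\int[mu]_x (((0 <= x) && (p <= x <= q))%R%:R *
     (2 * x / B * (`|x ^+ 2 - Z| <= B)%R%:R))%:E =
   \int[mu]_(c in `[(-1)%R, 1%R])
     (((0 <= Z + B * c) && (p <= Num.sqrt (Z + B * c) <= q))%R%:R : R)%:E)%E.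
Proof.
move=> B0 Z0; have [pq|qp] := leP (Num.max p 0) q; last first.
  rewrite integral_bool0 ?integral0_eq// => [c _|x].
    case: (boolP (_ && _)) => // /andP[_ /andP[pc cq]].
    have : Num.max p 0 <= q.
      by rewrite ge_max (le_trans pc)// (le_trans _ cq)// sqrtr_ge0.
    by rewrite leNgt qp.
  apply/negbTE/negP => /andP[x0 /andP[px xq]].
  have : Num.max p 0 <= q by rewrite ge_max !(le_trans _ xq).
  by rewrite leNgt qp.
have pq0 : 0 <= Num.max p 0 <= q by rewrite pq andbT le_max lexx orbT.
have q0 : 0 <= q by move: pq; rewrite ge_max => /andP[].
have := integral_sqr_window B0 pq0 Z0.
rewrite -integral_window// => E.
transitivity (\int[mu]_x ((Num.max p 0 <= x <= q)%R%:R *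
    (2 * x / B * (`|x ^+ 2 - Z| <= B)%R%:R))%:E)%E.
  apply: eq_integral => x _; congr ((nat_of_bool _)%:R * _)%:E.
  by rewrite ge_max; case: (p <= x); case: (0 <= x); case: (x <= q).
rewrite E; apply: eq_integral => c _; congr ((nat_of_bool _)%:R%:E).
by rewrite sqrt_window.
Qed.

(* The number of x in [s, t] with (x - m)^2 = y; the strict inequality prevents
   a double root from being counted twice. *)
Definition nroots m y s t : R :=
  ((0 <= y) && (s <= m + Num.sqrt y <= t))%:R +
  ((0 < y) && (s <= m - Num.sqrt y <= t))%:R.

Lemma measurable_sqrt d (T : measurableType d) (f : T -> R) :
  measurable_fun setT f -> measurable_fun setT (fun z : T => Num.sqrt (f z)).
Proof.
by move=> mf; apply: measurableT_comp => //; apply: continuous_measurable_fun;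
  exact: sqrt_continuous.
Qed.

Lemma measurable_nroots d (T : measurableType d) (f g : T -> R) s t :
  measurable_fun setT f -> measurable_fun setT g ->
  measurable_fun setT (fun z : T => nroots (f z) (g z) s t).
Proof.
move=> mf mg; apply: measurable_funD; apply: measurable_boolR;
  apply: measurable_and; try apply: measurable_fun_ler => //;
  try apply: measurable_fun_ltr => //; apply: measurable_itvR;
  [apply: measurable_funD|apply: measurable_funB] => //; exact: measurable_sqrt.
Qed.

Lemma nroots_ge0 m y s t : 0 <= nroots m y s t.
Proof. by rewrite addr_ge0. Qed.

(* |h' x| / B on the strip |h x| <= B, for h x = x^2 - Z and 0 <= x. *)
Definition strip_weight B Z x : R := 2 * x / B * (`|x ^+ 2 - Z| <= B)%R%:R.

Lemma measurable_strip_weight B Z : measurable_fun setT (strip_weight B Z).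
Proof.
apply: measurable_funM; first by apply: measurable_funM => //;
  exact: measurable_funM.
apply: measurable_boolR; apply: measurable_fun_ler => //.
by apply: measurableT_comp => //; apply: measurable_funB => //;
  exact: measurable_funX.
Qed.

Lemma strip_weight_ge0 B Z x : 0 < B -> 0 <= x -> 0 <= strip_weight B Z x.
Proof.
by move=> B0 x0; rewrite mulr_ge0// mulr_ge0 ?invr_ge0 ?(ltW B0)// mulr_ge0.
Qed.

(** Each of the roots m + sqrt y and m - sqrt y is one branch. The reflected second branch covers x
    <= m and the first x >= m, so together they give a weight in |x - m|. *)
Lemma integral_nroots_pos B Z m s t : 0 < B -> 0 <= Z ->
  (\int[mu]_(c in `[(-1)%R, 1%R]) (nroots m (Z + B * c) s t)%:E =
   \int[mu]_x ((s <= x <= t)%R%:R * strip_weight B Z `|x - m|)%:E)%E.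
Proof.
move=> B0 Z0.
have mB : measurable_fun setT (fun c : R => Z + B * c).
  by apply: measurable_funD => //; exact: measurable_funM.
have mw p q : measurable_fun setT
    (fun x => (((0 <= x) && (p <= x <= q))%R%:R * strip_weight B Z x)%:E).
  apply/measurable_EFinP; apply: measurable_funM;
    last exact: measurable_strip_weight.
  apply: measurable_boolR; apply: measurable_and;
    first exact: measurable_fun_ler.
  exact: measurable_itvR.
have w0 p q x :
    (0 <= (((0 <= x) && (p <= x <= q))%R%:R * strip_weight B Z x)%:E)%E.
  rewrite lee_fin; have [x0|x0] := leP 0 x; last by rewrite mul0r.
  by rewrite mulr_ge0// strip_weight_ge0.
have mc p q : measurable_fun setT
    (fun c =>
      (((0 <= Z + B * c) && (p <= Num.sqrt (Z + B * c) <= q))%R%:R : R)%:E).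
  apply/measurable_EFinP; apply: measurable_boolR; apply: measurable_and.
    exact: measurable_fun_ler.
  by apply: measurable_itvR; exact: measurable_sqrt.
transitivity (\int[mu]_(c in `[(-1)%R, 1%R])
  (((0 <= Z + B * c) && (s - m <= Num.sqrt (Z + B * c) <= t - m))%R%:R : R)%:E +
  \int[mu]_(c in `[(-1)%R, 1%R])
  (((0 <= Z + B * c) && (m - t <= Num.sqrt (Z + B * c) <= m - s))%R%:R :
    R)%:E)%E.
  rewrite -[RHS]ge0_integralD; last 5 first.
  - exact: measurable_itv.
  - by move=> c _; rewrite lee_fin.
  - by apply: measurable_funTS; exact: mc.
  - by move=> c _; rewrite lee_fin.
  - by apply: measurable_funTS; exact: mc.
  (* At c = - Z / B the radicand is 0: [nroots] counts the double root once, the two branches count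
     it twice. This single point is removed. *)
  have mD : measurable
      (`[(-1)%R, 1%R] `\ (- (Z / B)) : set (measurableTypeR R)).
    exact: measurableD.
  rewrite -(integral_setD1 mD); last first.
    apply: measurable_funTS; apply/measurable_EFinP; exact: measurable_nroots.
  rewrite -[RHS](integral_setD1 mD); last first.
    by apply: measurable_funTS; apply: emeasurable_funD.
  apply: eq_integral => c; rewrite inE/= => -[_ cB].
  rewrite /nroots EFinD;
    congr ((nat_of_bool _)%:R%:E + (nat_of_bool _)%:R%:E)%E.
    by congr (_ && _); apply/idP/idP; lra.
  have -> : (0 < Z + B * c) = (0 <= Z + B * c).
    rewrite lt_def; case: eqP => //= h; exfalso; apply: cB.
    have -> : Z = - (B * c) by lra.
    by field; rewrite gt_eqF.
  by congr (_ && _); apply/idP/idP; lra.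
rewrite -!integral_branch//.
rewrite -[X in (_ + X)%E](ge0_integral_reflect 0)//.
rewrite -[RHS](ge0_integral_shift m); last 2 first.
- apply/measurable_EFinP; apply: measurable_funM.
    by apply: measurable_boolR; exact: measurable_itvR.
  apply: measurableT_comp; first exact: measurable_strip_weight.
  by apply: measurableT_comp => //; exact: measurable_funB.
- by move=> x; rewrite lee_fin mulr_ge0// strip_weight_ge0.
rewrite -ge0_integralD//; last 2 first.
- exact: mw.
- pose f2 x :=
    (((0 <= x) && (m - t <= x <= m - s))%R%:R * strip_weight B Z x)%:E.
  by apply: (@measurableT_comp _ _ _ _ _ _ f2);
    [exact: mw|exact: measurable_funB].
apply: eq_integral => x _; rewrite -EFinD; congr EFin.
have -> : m + x - m = x by ring.
rewrite !sub0r -/(strip_weight B Z x) -/(strip_weight B Z (- x)).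
have -> : (s <= m + x <= t) = (s - m <= x <= t - m) by apply/idP/idP; lra.
have -> : (m - t <= - x <= m - s) = (s - m <= x <= t - m) by apply/idP/idP; lra.
rewrite oppr_ge0; have [x0|x0|->] := ltgtP x 0.
- by rewrite !mul0r add0r ltr0_norm.
- by rewrite mul0r addr0 gtr0_norm.
(* The branches overlap at 0, but the weight vanishes there. *)
- by rewrite normr0 oppr0 /strip_weight mulr0 !mul0r !mulr0 addr0.
Qed.

(** The range of [c] is symmetric, so the sign of [b] can be absorbed by replacing [c] with
    [- c]. *)
Lemma integral_nroots b Z m s t : b != 0 -> 0 <= Z ->
  (\int[mu]_(c in `[(-1)%R, 1%R]) (nroots m (Z + b * c) s t)%:E =
   \int[mu]_x ((s <= x <= t)%R%:R * strip_weight `|b| Z `|x - m|)%:E)%E.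
Proof.
move=> b0 Z0; rewrite -integral_nroots_pos ?normr_gt0//.
have [b0'|b0'] := ger0P b; first by [].
have := @ge0_integral_itvN _ (fun c => (nroots m (Z + b * c) s t)%:E) (-1) 1.
rewrite opprK => ->.
- by apply: eq_integral => c _; rewrite mulrN mulNr.
- apply/measurable_EFinP; apply: measurable_nroots => //.
  by apply: measurable_funD => //; exact: measurable_funM.
- by move=> c; rewrite lee_fin nroots_ge0.
Qed.

End area_formula.

(** * Eigenvalues and the joint law of the entries *)

Section eigenvalues.
Context {R : realType}.

Lemma eigenvalue_mx2 (M : 'M[R]_2) x :
  eigenvalue M x = ((M 0 0 - x) * (M 1 1 - x) == M 0 1 * M 1 0).
Proof.
rewrite /eigenvalue /eigenspace kermx_eq0 row_free_unit unitmxE unitfE negbK.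
rewrite (expand_det_row _ 0) !big_ord_recl big_ord0 /cofactor !det_mx11 !mxE/=.
have -> : lift 0 0 = 1 :> 'I_2 by exact: val_inj.
have -> : lift 1 0 = 0 :> 'I_2 by exact: val_inj.
rewrite /bump/= -[RHS]subr_eq0; congr (_ == _).
by rewrite !addn0 add0n expr0 expr1; ring.
Qed.

(** Completing the square puts the characteristic equation in the form (x - m)^2 = y with m half the
    trace. The solution set is then written as explicit singletons, whose cardinals [fset_set]
    computes. *)
Lemma num_eigenvaluesE (M : 'M[R]_2) s t :
  ((num_eigenvalues M s t)%:R : R) =
  nroots ((M 0 0 + M 1 1) / 2) (((M 0 0 - M 1 1) / 2) ^+ 2 + M 0 1 * M 1 0) s t.
Proof.
set m := (M 0 0 + _) / 2; set y := _ + _ * _.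
have eigE x : eigenvalue M x <-> (x - m) ^+ 2 = y.
  rewrite eigenvalue_mx2 /m /y; split => [/eqP h|h].
    by rewrite -h; field.
  have -> : M 0 1 * M 1 0 =
      (x - (M 0 0 + M 1 1) / 2) ^+ 2 - ((M 0 0 - M 1 1) / 2) ^+ 2.
    by rewrite h; ring.
  by apply/eqP; field.
rewrite /num_eigenvalues /nroots.
have -> : [set x | eigenvalue M x /\ s <= x <= t] =
    [set x | (x - m) ^+ 2 = y /\ s <= x <= t].
  by apply/seteqP; split => x /= [/eigE ? ?].
have [y0|y0] := ltP y 0.
  rewrite (_ : [set x | _] = set0) ?fset_set0 ?cardfs0; last first.
    apply/seteqP; split => x //= [xy _].
    by have := sqr_ge0 (x - m); rewrite xy leNgt y0.
  by rewrite (ltNge 0) (ltW y0)/= addr0.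
set r := Num.sqrt y.
have rE x : (x - m) ^+ 2 = y <-> x = m + r \/ x = m - r.
  rewrite -(sqr_sqrtr y0) -/r; split.
    by move/eqP; rewrite eqf_sqr => /orP[|] /eqP h; [left|right]; rewrite -h;
      ring.
  by case=> ->; ring.
rewrite [0 < y]lt_def y0 andbT /=.
have -> : [set x | (x - m) ^+ 2 = y /\ s <= x <= t] =
    [set x | x = m + r /\ s <= m + r <= t] `|`
    [set x | x = m - r /\ s <= m - r <= t].
  apply/seteqP; split => x /=.
    by case=> /rE[] -> h; [left|right].
  by case=> -[->] h; split => //; apply/rE; [left|right].
have setE (z : R) : [set x | x = z /\ s <= z <= t] =
    if s <= z <= t then [set z] else set0.
  by case: ifPn => h; apply/seteqP; split => x //=; [case|case].
rewrite !setE; have [yE|yn0] := eqVneq y 0.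
  rewrite /r yE sqrtr0 subr0 addr0 setUid /=.
  by case: ifPn => _; rewrite ?fset_set1 ?fset_set0 ?cardfs1 ?cardfs0 addr0.
have r0 : 0 < r by rewrite sqrtr_gt0 lt_def yn0.
rewrite /=; case: ifPn => _; case: ifPn => _.
- rewrite fset_setU// !fset_set1 cardfs2.
  have -> : m + r == m - r = false by apply/negbTE/eqP; lra.
  by rewrite -natrD.
- by rewrite setU0 fset_set1 cardfs1 addr0.
- by rewrite set0U fset_set1 cardfs1 add0r.
- by rewrite setU0 fset_set0 cardfs0 addr0.
Qed.
End eigenvalues.

(** * The joint law of the four entries *)

Section joint_law.
Context {R : realType} d (T : measurableType d) (P : probability T R).

(** Conditionally on [E], the law of the pair agrees with the product measure on rectangles, hence
    everywhere. The event [E] holds the constraints on the other entries, so the joint law can be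
    assembled one factor at a time. *)
Lemma product_law d1 d2 (S1 : measurableType d1) (S2 : measurableType d2)
    (m1 : probability S1 R) (m2 : probability S2 R)
    (E : set T) (Y : T -> S1) (Z : T -> S2) :
  measurable E -> measurable_fun setT Y -> measurable_fun setT Z ->
  (forall A B, measurable A -> measurable B ->
    P (E `&` (Y @^-1` A `&` Z @^-1` B)) = P E * (m1 A * m2 B))%E ->
  forall C, measurable C ->
    P (E `&` (fun w => (Y w, Z w)) @^-1` C) = (P E * (m1 \x m2) C)%E.
Proof.
move=> mE mY mZ EYZ C mC.
have mYZ : measurable_fun setT (fun w => (Y w, Z w)) by exact:
  measurable_fun_pair.
have mYZC : measurable ((fun w => (Y w, Z w)) @^-1` C).
  by rewrite -[X in measurable X]setTI; exact: mYZ.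
(* Conditioning divides by P E, so a null event is treated apart; both sides are then 0. *)
have [PE0|PE0] := eqVneq (P E) 0%E.
  rewrite PE0 mul0e; apply/eqP; rewrite eq_le measure_ge0 andbT -PE0.
  by apply: le_measure; rewrite ?inE//; exact: measurableI.
have PEfin : P E \is a fin_num by exact: fin_num_measure.
have k0 : 0 <= (fine (P E))^-1 by rewrite invr_ge0 fine_ge0.
have kP : ((fine (P E))^-1%:E * P E = 1)%E.
  rewrite -[X in (_ * X)%E](fineK PEfin) -EFinM mulVf//.
  by rewrite fine_eq0.
pose YZ w := (Y w, Z w).
pose m0 : {measure set (S1 * S2) -> \bar R} :=
  mscale (NngNum k0) (pushforward (mrestr P mE) YZ).
pose m' := m0 mYZ.
have m'E A : m' A = ((fine (P E))^-1%:E * P (E `&` YZ @^-1` A))%E.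
  by rewrite setIC.
rewrite (@product_measure_unique _ _ _ _ _ m1 m2 m')//.
  by rewrite m'E muleA muleC [X in (_ * X)%E]muleC kP mule1.
move=> A B mA mB; rewrite m'E.
rewrite (_ : YZ @^-1` _ = Y @^-1` A `&` Z @^-1` B)//.
by rewrite EYZ// muleA kP mul1e.
Qed.

Context (X : 'I_2 * 'I_2 -> {RV P >-> R}).
Local Notation U := (uniform_prob (ltN1_1 R)).
Local Notation RR := (measurableTypeR R).

(** Independence over the full index set, with the factors reordered to match the later integration:
    diagonal entries outermost, then the entries b and c. *)
Lemma entries_rect A1 A2 A3 A4 : uniform_entries X ->
  measurable A1 -> measurable A2 -> measurable A3 -> measurable A4 ->
  P (X (0, 0) @^-1` A1 `&` (X (1, 1) @^-1` A2 `&`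
    (X (0, 1) @^-1` A3 `&` X (1, 0) @^-1` A4))) =
  (U A1 * (U A2 * (U A3 * U A4)))%E.
Proof.
move=> [indX unifX] m1 m2 m3 m4.
pose A (ij : 'I_2 * 'I_2) : set R :=
  if ij.1 == 0 then (if ij.2 == 0 then A1 else A3)
  else (if ij.2 == 0 then A4 else A2).
have mA ij : measurable (A ij) by rewrite /A; case: ifP => _; case: ifP.
have := indX (finset.setTfor ('I_2 * 'I_2)%type) A mA.
rewrite (eq_bigl xpredT); last by move=> ij; rewrite inE.
rewrite (eq_bigr (fun ij => P (X (ij.1, ij.2) @^-1` A (ij.1, ij.2))));
  last by case.
rewrite -(pair_bigA _ (fun i j => P (X (i, j) @^-1` A (i, j)))) /=.
rewrite !big_ord_recl !big_ord0 !mule1.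
have -> : lift ord0 ord0 = 1 :> 'I_2 by exact: val_inj.
have PX i j : P (X (i, j) @^-1` A (i, j)) = U (A (i, j)).
  by rewrite -(unifX (i, j)).
rewrite !PX /A/= => H.
transitivity (U A1 * U A3 * (U A4 * U A2))%E; last first.
  by rewrite -!muleA; congr (_ * _)%E; rewrite muleCA muleC -muleA muleCA.
rewrite -H; congr (P _); apply/seteqP; split => w /=.
  move=> [w1 [w2 [w3 w4]]] [i j] _; have I2P (k : 'I_2) : k = 0 \/ k = 1.
    by case: k => [[|[|//]] hk]; [left|right]; exact: val_inj.
  by case: (I2P i) => ->; case: (I2P j) => ->.
move=> h; split; first by apply: (h (0, 0)); rewrite /= inE.
split; first by apply: (h (1, 1)); rewrite /= inE.
by split; [apply: (h (0, 1))|apply: (h (1, 0))]; rewrite /= inE.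
Qed.

Lemma ge0_expectation_entries (f : RR * (RR * (RR * RR)) -> \bar R) :
  uniform_entries X ->
  measurable_fun setT f -> (forall z, 0 <= f z)%E ->
  (\int[P]_w f (X (0, 0) w, (X (1, 1) w, (X (0, 1) w, X (1, 0) w)))%R =
   \int[U \x (U \x (U \x U))]_z f z)%E.
Proof.
move=> hX mf f0.
have U1 : U setT = 1%E by exact: probability_setT.
have mX ij (A : set R) : measurable A -> measurable (X ij @^-1` A).
  by move=> mA; rewrite -[X in measurable X]setTI; exact: measurable_funP.
have mXf ij : measurable_fun setT (X ij) by exact: measurable_funP.
(* The product law is built from the inside out: [s1] handles the off-diagonal pair, [s2] adds the
   second diagonal entry and [s3] the first. *)
have s1 A1 A2 C : measurable A1 -> measurable A2 -> measurable C ->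
    P ((X (0, 0) @^-1` A1 `&` X (1, 1) @^-1` A2) `&`
       (fun w => (X (0, 1) w, X (1, 0) w)) @^-1` C) =
    (U A1 * U A2 * (U \x U) C)%E.
  move=> m1 m2 mC.
  have PE : P (X (0, 0) @^-1` A1 `&` X (1, 1) @^-1` A2) = (U A1 * U A2)%E.
    have := @entries_rect A1 A2 setT setT hX m1 m2 measurableT measurableT.
    by rewrite !preimage_setT !setIT U1 !mule1.
  rewrite -PE; apply: (@product_law _ _ _ _ U U) => //.
  - by apply: measurableI; exact: mX.
  - exact: mXf.
  - exact: mXf.
  - by move=> A B mA mB; rewrite -setIA entries_rect// PE muleA.
have m23 : measurable_fun setT (fun w => (X (0, 1) w, X (1, 0) w)).
  exact: measurable_fun_pair.
have m123 : measurable_fun setT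
    (fun w => (X (1, 1) w, (X (0, 1) w, X (1, 0) w))).
  exact: measurable_fun_pair.
have s2 A1 C : measurable A1 -> measurable C ->
    P (X (0, 0) @^-1` A1 `&`
       (fun w => (X (1, 1) w, (X (0, 1) w, X (1, 0) w))) @^-1` C) =
    (U A1 * (U \x (U \x U)) C)%E.
  move=> m1 mC.
  have PE : P (X (0, 0) @^-1` A1) = U A1 by rewrite -(hX.2 (0, 0)).
  rewrite -PE. apply: (@product_law _ _ _ _ U (U \x U)%E _ (X (1, 1))
    (fun w => (X (0, 1) w, X (1, 0) w))) => //.
  - exact: mX.
  - exact: mXf.
  - by move=> A B mA mB; rewrite setIA s1// PE muleA.
pose g w : RR * (RR * (RR * RR)) :=
  (X (0, 0) w, (X (1, 1) w, (X (0, 1) w, X (1, 0) w))).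
have mg : measurable_fun setT g.
  by apply: measurable_fun_pair; [exact: mXf|exact: m123].
have s3 C : measurable C -> pushforward P g C = (U \x (U \x (U \x U)))%E C.
  move=> mC; rewrite /pushforward -[X in P X]setTI -[RHS]mul1e.
  rewrite -(@probability_setT _ _ _ P).
  apply: (@product_law _ _ _ _ U (U \x (U \x U))%E _ (X (0, 0))
    (fun w => (X (1, 1) w, (X (0, 1) w, X (1, 0) w)))) => //; first exact: mXf.
  by move=> A B mA mB; rewrite setTI s2// probability_setT mul1e.
transitivity (\int[P]_(w in g @^-1` setT) (f \o g) w)%E => //.
rewrite -(ge0_integral_pushforward mg)//.
pose V : probability _ R := (U \x (U \x (U \x U)))%E.
by apply: (@eq_measure_integral _ _ _ setT V) => C mC _; exact: s3.
Qed.
End joint_law.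

(** * The expected number of eigenvalues *)

Section integration_over_entries.
Context {R : realType}.
Implicit Types (x y u v a b c e k p q s t m B Z : R).
Local Notation mu := (@lebesgue_measure R).
Local Notation U := (uniform_prob (ltN1_1 R)).
Local Notation RR := (measurableTypeR R).

Lemma measurable_invr : measurable_fun setT (@GRing.inv R).
Proof.
have -> : @GRing.inv R = (fun x => if x == 0 then 0 else x^-1).
  by apply/funext => x; case: eqP => // ->; rewrite invr0.
apply: measurable_fun_if => //; first exact: measurable_fun_eqr.
rewrite setTI (_ : _ @^-1` _ = [set x | x != 0]); last first.
  by apply/seteqP; split => x /=; [move/negbT|move/negPf].
apply: open_continuous_measurable_fun; first exact: open_neq.
by move=> x /set_mem x0; apply: cvgV => //; exact: cvg_id.
Qed.

Lemma integral_uniformN1 (f : R -> \bar R) :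
  measurable_fun setT f -> (forall x, 0 <= f x)%E ->
  (\int[U]_x f x = 2^-1%:E * \int[mu]_(x in `[(-1)%R, 1%R]) f x)%E.
Proof.
move=> mf f0; rewrite integral_uniform//; congr (_%:E * _)%E.
by rewrite opprK.
Qed.

(** The logarithm of [kappa] arises as the integral of 1 / b from |p| to 1. At p = 0 the integral
    diverges, whereas [ln 0] is 0. *)
Lemma integral_inv_window p : p != 0 ->
  (\int[mu]_(b in `[0%R, 1%R]) (b^-1 * (`|p| <= b)%R%:R)%:E =
   (Num.max 0 (- ln `|p|))%:E)%E.
Proof.
move=> p0; have ap : 0 < `|p| by rewrite normr_gt0.
transitivity (\int[mu]_b ((`|p| <= b <= 1)%R%:R * b^-1)%:E)%E.
  rewrite integral_mkcond; apply: eq_integral => b _.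
  rewrite patchE mem_setE in_itv/= mulrC.
  have [pb|pb] := leP `|p| b; last by rewrite mul0r; case: ifP.
  by rewrite (le_trans (ltW ap) pb)/=; case: ifP; rewrite ?mul0r.
rewrite (@integral_itv_bool _ _ `|p| 1)//.
have [p1|p1] := ltP `|p| 1; last first.
  rewrite max_l; last by rewrite oppr_le0 ln_ge0.
  move: p1; rewrite le_eqVlt => /predU1P[<-|p1].
    by rewrite set_itv1 integral_set1.
  by rewrite set_itv_ge ?integral_set0// bnd_simp -ltNge.
rewrite max_r; last by rewrite oppr_ge0 ln_le0// ltW.
rewrite (@ge0_FTC_oo_ext _ _ (fun b => b^-1) (@ln R) _ _ p1).
- by rewrite ln1 sub0r.
- apply: continuous_in_subspaceT => b /set_mem/=;
    rewrite in_itv/= => /andP[pb _].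
  by apply: continuous_ln; exact: lt_le_trans pb.
- move=> b; rewrite in_itv/= => /andP[pb _].
  by apply: cvgV; [rewrite gt_eqF// (lt_trans ap)|exact: cvg_id].
- move=> b; rewrite in_itv/= => /andP[pb _].
  by rewrite invr_ge0 ltW// (lt_trans ap).
- move=> b; rewrite in_itv/= => /andP[pb _].
  by apply: is_derive1_ln; exact: lt_trans pb.
- by [].
Qed.

(** The integrand is even in [b], so doubling the integral over [0, 1] cancels the density 1/2. *)
Lemma integral_strip_weight y Z : 0 <= y -> y ^+ 2 - Z != 0 ->
  (\int[U]_b (strip_weight `|b| Z y)%:E =
   (2 * y * Num.max 0 (- ln `|y ^+ 2 - Z|))%:E)%E.
Proof.
move=> y0 p0; set p := y ^+ 2 - Z.
pose g b : \bar R := (strip_weight `|b| Z y)%:E.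
have mg : measurable_fun setT g.
  apply/measurable_EFinP; apply: measurable_funM.
    apply: measurable_funM => //; apply: (measurableT_comp measurable_invr).
    exact: normr_measurable.
  by apply: measurable_boolR; apply: measurable_fun_ler.
have g0 b : (0 <= g b)%E.
  by rewrite lee_fin mulr_ge0// mulr_ge0 ?invr_ge0// mulr_ge0.
have gN b : g (- b) = g b by rewrite /g normrN.
rewrite integral_uniformN1// (@ge0_integral_itvD _ _ _ 0)//; last by lra.
have -> : (\int[mu]_(b in `[(-1)%R, 0%R]) g b =
    \int[mu]_(b in `[0%R, 1%R]) g b)%E.
  have := @ge0_integral_itvN _ g 0 1 mg g0; rewrite oppr0 => ->.
  by apply: eq_integral => b _.
have -> : (\int[mu]_(b in `[0%R, 1%R]) g b =
    (2 * y * Num.max 0 (- ln `|p|))%:E)%E.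
  rewrite EFinM -integral_inv_window// -ge0_integralZl_EFin//; last 3 first.
  - move=> b; rewrite /= in_itv/= => /andP[b0 _].
    by rewrite lee_fin mulr_ge0// invr_ge0.
  - apply/measurable_EFinP/measurable_funTS; apply: measurable_funM.
      exact: measurable_invr.
    by apply: measurable_boolR; exact: measurable_fun_ler.
  - by rewrite mulr_ge0.
  apply: eq_integral => b; rewrite inE/= in_itv/= => /andP[b0 _].
  by rewrite /g /strip_weight ger0_norm// -EFinM mulrA.
by rewrite -EFinD -EFinM; congr EFin; field.
Qed.

Lemma uniform_set1 (r : R) : U [set r] = 0%E.
Proof. exact: integral_set1. Qed.

(** Stated for any measure that is null on points, to serve both Lebesgue measure and the uniform
    law. *)
Lemma ae_eq_finite (m0 : {measure set RR -> \bar R}) (l : seq R) (D : set R)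
    (f g : R -> \bar R) :
  (forall r, m0 [set r] = 0%E) -> (forall x, x \notin l -> f x = g x) ->
  ae_eq m0 D f g.
Proof.
move=> m00 fg.
have : m0.-negligible [set` l].
  elim: l {fg} => [|r l IHl].
    by rewrite (_ : [set` _] = set0);
      [exact: negligible_set0|apply/seteqP; split => x].
  rewrite (_ : [set` _] = [set r] `|` [set` l]); last first.
    by apply/seteqP; split => x /=; rewrite inE => /predU1P.
  by apply: negligibleU => //; exists [set r]; split => //; exact: m00.
move=> [N [mN N0 lN]]; exists N; split => //; apply: subset_trans lN.
move=> x /= fgx; apply/negPn/negP => xl; apply: fgx => _; exact: fg.
Qed.

Lemma measurable_strip_weight_pair d (T : measurableType d) (f g : T -> R) Z :
  measurable_fun setT f -> measurable_fun setT g ->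
  measurable_fun setT (fun z => strip_weight (f z) Z (g z)).
Proof.
move=> mf mg; apply: measurable_funM.
  apply: measurable_funM; first exact: measurable_funM.
  exact: (measurableT_comp measurable_invr).
apply: measurable_boolR; apply: measurable_fun_ler => //.
apply: (measurableT_comp (@normr_measurable R setT)).
by apply: measurable_funB => //; exact: measurable_funX.
Qed.

Lemma integral_offdiagonal a e s t :
  (\int[U]_b \int[U]_c
     (nroots ((a + e) / 2) (((a - e) / 2) ^+ 2 + b * c) s t)%:E =
   \int[mu]_x ((s <= x <= t)%R%:R * (kappa (x - a) (x - e) / 2))%:E)%E.
Proof.
set m := (a + e) / 2; set Z := ((a - e) / 2) ^+ 2.
have Z0 : 0 <= Z by exact: sqr_ge0.
pose F (z : RR * RR) := (nroots m (Z + z.1 * z.2) s t)%:E.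
have mF : measurable_fun setT F.
  apply/measurable_EFinP; apply: measurable_nroots => //.
  by apply: measurable_funD => //; exact: measurable_funM.
have F0 z : (0 <= F z)%E by rewrite lee_fin nroots_ge0.
(* The integrand left after integrating over [c]; the factor 1/2 is the density of [c]. *)
pose G (z : RR * RR) :=
  (2^-1 * ((s <= z.2 <= t)%R%:R * strip_weight `|z.1| Z `|z.2 - m|))%:E.
have mG : measurable_fun setT G.
  apply/measurable_EFinP; apply: measurable_funM => //; apply: measurable_funM.
    by apply: measurable_boolR; exact: measurable_itvR.
  apply: measurable_strip_weight_pair.
    exact: (measurableT_comp (@normr_measurable R setT)).
  apply: (measurableT_comp (@normr_measurable R setT)).
  exact: measurable_funB.
have sw0 b y : 0 <= strip_weight `|b| Z `|y|.
  by rewrite mulr_ge0// mulr_ge0 ?invr_ge0// mulr_ge0.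
have G0 z : (0 <= G z)%E by rewrite lee_fin !mulr_ge0.
transitivity (\int[U]_b \int[mu]_x G (b, x))%E.
  apply: ge0_ae_eq_integral => //.
  - exact: (measurable_fun_fubini_tonelli_F F).
  - exact: (measurable_fun_fubini_tonelli_F G).
  - by move=> b _; apply: integral_ge0 => c _; rewrite lee_fin nroots_ge0.
  - by move=> b _; apply: integral_ge0 => x _; exact: G0.
  (* The area formula needs a nonzero slope in [c], so b = 0 is excluded. *)
  apply: (@ae_eq_finite _ [:: 0]); first exact: uniform_set1.
  move=> b; rewrite inE => b0.
  rewrite integral_uniformN1; last 2 first.
  - apply/measurable_EFinP; apply: measurable_nroots => //.
    by apply: measurable_funD => //; exact: measurable_funM.
  - by move=> c; rewrite lee_fin nroots_ge0.
  rewrite integral_nroots// /G/= -ge0_integralZl_EFin//.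
  - by move=> x _; rewrite lee_fin mulr_ge0.
  - apply/measurable_EFinP; apply: measurable_funM.
      by apply: measurable_boolR; exact: measurable_itvR.
    apply: (measurableT_comp (measurable_strip_weight `|b| Z)).
    apply: (measurableT_comp (@normr_measurable R setT)).
    exact: measurable_funB.
transitivity (\int[mu]_x \int[U]_b G (b, x))%E; first exact: fubini_tonelli.
apply: ge0_ae_eq_integral => //.
- exact: (measurable_fun_fubini_tonelli_G G).
- apply/measurable_EFinP; apply: measurable_funM.
    by apply: measurable_boolR; exact: measurable_itvR.
  apply: measurable_funM => //; apply/measurable_EFinP.
  by apply: measurable_kappa; exact: measurable_funB.
- by move=> x _; apply: integral_ge0 => b _; exact: G0.
- by move=> x _; rewrite lee_fin mulr_ge0// mulr_ge0// kappa_ge0.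
(* At x = a and x = e the product (x - a) (x - e) vanishes and the integral over [b] may diverge. *)
apply: (@ae_eq_finite _ [:: a; e]); first exact: lebesgue_measure_set1.
move=> x; rewrite !inE negb_or => /andP[xa xe].
have pE : `|x - m| ^+ 2 - Z = (x - a) * (x - e).
  by rewrite real_normK ?num_real// /m /Z; field.
have p0 : `|x - m| ^+ 2 - Z != 0 by rewrite pE mulf_neq0// subr_eq0.
transitivity (((s <= x <= t)%R%:R / 2)%:E *
    \int[U]_b (strip_weight `|b| Z `|x - m|)%:E)%E.
  rewrite -ge0_integralZl_EFin//; last 2 first.
  - by move=> b _; rewrite lee_fin.
  - by apply/measurable_EFinP; apply: measurable_strip_weight_pair.
  by apply: eq_integral => b _; rewrite /G/= -EFinM; congr EFin; ring.
rewrite integral_strip_weight// pE -EFinM; congr EFin.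
rewrite /kappa; have -> : x - a + (x - e) = 2 * (x - m) by rewrite /m; field.
have -> : `|2 * (x - m)| = 2 * `|x - m| by rewrite normrM ger0_norm.
by field.
Qed.

End integration_over_entries.

(** * Averaging over the diagonal entries *)

Section expected_number.
Context {R : realType}.
Implicit Types (x y u v a b c e k p q s t m B Z : R).
Local Notation mu := (@lebesgue_measure R).
Local Notation U := (uniform_prob (ltN1_1 R)).
Local Notation RR := (measurableTypeR R).

Lemma integral_uniform_reflect x (g : R -> \bar R) :
  measurable_fun setT g -> (forall y, 0 <= g y)%E ->
  (\int[U]_y g (x - y)%R =
   2^-1%:E * \int[mu]_(y in `[(x - 1)%R, (x + 1)%R]) g y)%E.
Proof.
move=> mg g0; rewrite integral_uniformN1//; last first.
  pose h (y : RR) : RR := x - y.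
  have mh : measurable_fun setT h by exact: measurable_funB.
  exact: (measurableT_comp mg mh).
by rewrite (ge0_integral_itv_reflect x (-1) 1)// opprK.
Qed.

Lemma kappa_squareE_uniform x :
  (\int[U]_a \int[U]_e (kappa (x - a) (x - e))%:E = 4^-1%:E * kappa_square x)%E.
Proof.
under eq_integral => a _.
  rewrite (@integral_uniform_reflect x (fun v => (kappa (x - a) v)%:E));
    last 2 first.
  - exact: measurable_kappa.
  - by move=> y; rewrite lee_fin kappa_ge0.
  over.
rewrite /= (@integral_uniform_reflect x (fun u => 2^-1%:E *
  \int[mu]_(y in `[(x - 1)%R, (x + 1)%R]) (kappa u y)%:E)%E); last 2 first.
- by apply: emeasurable_funM => //; exact: measurable_integral_kappa.
- move=> y; rewrite mule_ge0//.
  by apply: integral_ge0 => v _; rewrite lee_fin kappa_ge0.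
rewrite ge0_integralZl_EFin//; last 2 first.
- by move=> y _; apply: integral_ge0 => v _; rewrite lee_fin kappa_ge0.
- by apply: measurable_funTS; exact: measurable_integral_kappa.
by rewrite muleA -EFinM; congr (_%:E * _)%E; field.
Qed.

(** Taken as a function of the pair of a diagonal entry and x, so that Tonelli can exchange the
    integrals over these two. *)
Definition kappa_mean (z : RR * RR) : \bar R :=
  (\int[U]_e (kappa (z.2 - z.1) (z.2 - e))%:E)%E.

Lemma measurable_kappa_mean : measurable_fun setT kappa_mean.
Proof.
pose h (w : (RR * RR) * RR) := (kappa (w.1.2 - w.1.1) (w.1.2 - w.2))%:E.
have mh : measurable_fun setT h.
  have m1 : measurable_fun setT (fun w : (RR * RR) * RR => w.1.1).
    exact: (measurableT_comp measurable_fst).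
  have m2 : measurable_fun setT (fun w : (RR * RR) * RR => w.1.2).
    exact: (measurableT_comp measurable_snd).
  by apply: measurable_kappa; apply: measurable_funB.
apply: (measurable_fun_fubini_tonelli_F h mh) => w.
by rewrite lee_fin kappa_ge0.
Qed.

Lemma kappa_mean_ge0 z : (0 <= kappa_mean z)%E.
Proof. by apply: integral_ge0 => e _; rewrite lee_fin kappa_ge0. Qed.

Lemma measurable_kappa_square : measurable_fun setT (@kappa_square R).
Proof.
have -> : @kappa_square R = (fun x => 4%:E * \int[U]_a kappa_mean (a, x))%E.
  apply/funext => x; rewrite kappa_squareE_uniform muleA -EFinM divff//.
  by rewrite mul1e.
apply: emeasurable_funM => //.
apply: (measurable_fun_fubini_tonelli_G kappa_mean) => //.
- exact: measurable_kappa_mean.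
- exact: kappa_mean_ge0.
Qed.

Definition entries_nroots s t (z : RR * (RR * (RR * RR))) : \bar R :=
  (nroots ((z.1 + z.2.1) / 2)
    (((z.1 - z.2.1) / 2) ^+ 2 + z.2.2.1 * z.2.2.2) s t)%:E.

Lemma measurable_entries_nroots s t : measurable_fun setT (entries_nroots s t).
Proof.
apply/measurable_EFinP; apply: measurable_nroots.
  by apply: measurable_funM => //; apply: measurable_funD => //;
    exact: measurableT_comp.
apply: measurable_funD.
  apply: measurable_funX; apply: measurable_funM => //.
  by apply: measurable_funB => //; exact: measurableT_comp.
apply: measurable_funM.
  by apply: measurableT_comp => //; exact: measurableT_comp.
by apply: measurableT_comp => //; exact: measurableT_comp.
Qed.

Lemma entries_nroots_ge0 s t z : (0 <= entries_nroots s t z)%E.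
Proof. by rewrite lee_fin nroots_ge0. Qed.

(** The off-diagonal entries are integrated first; then the integral over x is moved outside those
    over [e] and [a]. The factor 1/8 is 1/2 from [integral_offdiagonal] times 1/4 from
    [kappa_squareE_uniform]. *)
Lemma integral_entries_nroots s t :
  (\int[U \x (U \x (U \x U))]_z entries_nroots s t z =
   \int[mu]_(x in `[s, t]) (8^-1%:E * kappa_square x))%E.
Proof.
set f := entries_nroots s t.
have mf : measurable_fun setT f by exact: measurable_entries_nroots.
have f0 z : (0 <= f z)%E by exact: entries_nroots_ge0.
pose U2 : probability _ R := (U \x U)%E.
pose U3 : probability _ R := (U \x U2)%E.
have E1 : (\int[U \x U3]_z f z = \int[U]_a \int[U3]_z f (a, z))%E.
  exact: fubini_tonelli1.
rewrite E1.
pose k (a e x : R) : \bar R :=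
  ((s <= x <= t)%R%:R * (kappa (x - a) (x - e) / 2))%:E.
transitivity (\int[U]_a \int[U]_e \int[mu]_x k a e x)%E.
  apply: eq_integral => a _.
  have m1 : measurable_fun setT (fun z => f (a, z)) by exact: measurableT_comp.
  have E2 : (\int[U \x U2]_z f (a, z) = \int[U]_e \int[U2]_z f (a, (e, z)))%E.
    by apply: (fubini_tonelli1 (fun z => f (a, z))).
  rewrite E2; apply: eq_integral => e _.
  have m2 : measurable_fun setT (fun z => f (a, (e, z))).
    by apply: (measurableT_comp m1).
  have E3 : (\int[U \x U]_z f (a, (e, z)) =
      \int[U]_b \int[U]_c f (a, (e, (b, c))))%E.
    by apply: (fubini_tonelli1 (fun z => f (a, (e, z)))).
  by rewrite E3 -integral_offdiagonal.
pose w x : R := (s <= x <= t)%R%:R / 2.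
have w0 x : 0 <= w x by rewrite mulr_ge0.
have mw : measurable_fun setT w.
  by apply: measurable_funM => //; apply: measurable_boolR;
    exact: measurable_itvR.
pose h (z : RR * RR) : \bar R := ((w z.2)%:E * kappa_mean z)%E.
have mh : measurable_fun setT h.
  apply: emeasurable_funM; last exact: measurable_kappa_mean.
  by apply/measurable_EFinP; exact: (measurableT_comp mw).
have h0 z : (0 <= h z)%E by rewrite mule_ge0// ?lee_fin// kappa_mean_ge0.
transitivity (\int[U]_a \int[mu]_x h (a, x))%E.
  apply: eq_integral => a _.
  pose g (z : RR * RR) := k a z.1 z.2.
  have mg : measurable_fun setT g.
    apply/measurable_EFinP; apply: measurable_funM.
      by apply: measurable_boolR; exact: measurable_itvR.
    apply: measurable_funM => //; apply/measurable_EFinP.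
    by apply: measurable_kappa; exact: measurable_funB.
  have g0 z : (0 <= g z)%E by rewrite lee_fin mulr_ge0// divr_ge0// kappa_ge0.
  transitivity (\int[mu]_x \int[U]_e g (e, x))%E; first exact: fubini_tonelli.
  apply: eq_integral => x _; rewrite /h /kappa_mean/= -ge0_integralZl_EFin//.
  - by apply: eq_integral => e _; rewrite /g /k/= -EFinM; congr EFin;
      rewrite /w; ring.
  - by move=> e _; rewrite lee_fin kappa_ge0.
  - by apply: measurable_kappa => //; exact: measurable_funB.
transitivity (\int[mu]_x \int[U]_a h (a, x))%E; first exact: fubini_tonelli.
rewrite [RHS]integral_mkcond; apply: eq_integral => x _.
rewrite patchE mem_setE in_itv/= /h/=.
rewrite ge0_integralZl_EFin//; last 2 first.
- by move=> a _; exact: kappa_mean_ge0.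
- have mp : measurable_fun setT (fun a : RR => (a, x) : RR * RR).
    by exact: measurable_fun_pair.
  exact: (measurableT_comp measurable_kappa_mean mp).
rewrite kappa_squareE_uniform muleA -EFinM /w.
case: ifP => _; last by rewrite !mul0r mul0e.
by congr (_%:E * _)%E; rewrite -[true%:R]/(1 : R); field.
Qed.
End expected_number.

(** * Existence and uniqueness of the density *)

Section density_uniqueness.
Context {R : realType}.
Implicit Types (f g : R -> R) (x y s t : R).
Local Notation mu := (@lebesgue_measure R).

(** The integral is the difference of those of the positive and negative parts, and such a
    difference is finite only if both terms are. *)
Lemma integrable_fin_num_integral f (D : set R) : measurable D ->
  measurable_fun D f -> (\int[mu]_(x in D) (f x)%:E)%E \is a fin_num ->
  mu.-integrable D (EFin \o f).
Proof.
move=> mD mf; rewrite integralE fin_numB => /andP[fp fn].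
have mEf : measurable_fun D (EFin \o f) by exact/measurable_EFinP.
apply/integrableP; split => //.
have -> : (\int[mu]_(x in D) `|(EFin \o f) x| =
    \int[mu]_(x in D) ((EFin \o f)^\+ x) +
    \int[mu]_(x in D) ((EFin \o f)^\- x))%E.
  rewrite -ge0_integralD//.
  - by rewrite -[LHS]/(\int[mu]_(x in D) (abse \o (EFin \o f)) x)%E fune_abse.
  - exact: measurable_funepos.
  - exact: measurable_funeneg.
by rewrite ltey_eq fin_numD fp fn.
Qed.

Lemma locally_integrable_itv f : measurable_fun setT f ->
  (forall s t, s <= t -> mu.-integrable `[s, t] (EFin \o f)) ->
  locally_integrable setT f.
Proof.
move=> mf intf; split => //; first exact: openT.
move=> K _ cK; have [M [_ KM]] := compact_bounded cK.
pose N := `|M| + 1.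
have MN : M < N by rewrite (le_lt_trans (ler_norm _))// ltrDl.
have KN : K `<=` `[- N, N].
  by move=> x Kx; have := KM _ MN x Kx; rewrite /= ler_norml in_itv/=.
have N0 : - N <= N by rewrite ge0_cp// addr_ge0.
have /integrableP[_] := intf _ _ N0.
apply: le_lt_trans; apply: ge0_subset_integral => //.
- exact: compact_measurable.
- apply: measurable_funTS; apply/measurable_EFinP.
  exact: (measurableT_comp (@normr_measurable R setT)).
Qed.

(** The difference h = f - g is locally integrable with zero integral over every interval, so its
    primitive is constant; at almost every x the derivative of the primitive is h x. *)
Lemma ae_eq_integral_itv f g : measurable_fun setT f -> measurable_fun setT g ->
  (forall s t, s <= t -> (\int[mu]_(x in `[s, t]) (g x)%:E)%E \is a fin_num) ->
  (forall s t, s <= t ->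
    (\int[mu]_(x in `[s, t]) (f x)%:E = \int[mu]_(x in `[s, t]) (g x)%:E)%E) ->
  {ae mu, forall x, f x = g x}.
Proof.
move=> mf mg fing fg.
have intf s t : s <= t -> mu.-integrable `[s, t] (EFin \o f).
  move=> st; apply: integrable_fin_num_integral => //;
    last by rewrite fg// fing.
  exact: measurable_funTS.
have intg s t : s <= t -> mu.-integrable `[s, t] (EFin \o g).
  move=> st; apply: integrable_fin_num_integral => //; last exact: fing.
  exact: measurable_funTS.
pose h x := f x - g x.
have mh : measurable_fun setT h by exact: measurable_funB.
have inth s t : s <= t -> mu.-integrable `[s, t] (EFin \o h).
  move=> st; have := integrableB _ (intf _ _ st) (intg _ _ st).
  by apply.
have h0 s t : s <= t -> (\int[mu]_(x in `[s, t]) (h x)%:E = 0)%E.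
  move=> st; rewrite integralB_EFin//; [|exact: intf|exact: intg].
  by rewrite fg// subee// fing.
have /lebesgue_differentiation := locally_integrable_itv mh inth.
apply: filterS; first exact: (ae_filter_ringOfSetsType mu).
move=> x hx.
have x1 : x < x + 1 by rewrite ltrDl.
have xx1 : x - 1 <= x + 1 by lra.
have bx : ((x - 1)%:E < x%:E)%E by rewrite lte_fin gtrBl.
have [_ H] := @FTC1_lebesgue_pt R h (BLeft (x - 1)) x (x + 1) x1 (inth _ _ xx1)
  bx hx.
apply/eqP; rewrite -subr_eq0 -/(h x) -H.
(* For y < x - 1 the interval is empty, so the primitive is 0 there too. *)
rewrite (_ : (fun y => _) = cst 0); first by rewrite derive1_cst.
apply/funext => y; rewrite /Rintegral.
have [xy|yx] := leP (x - 1) y; first by rewrite h0.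
by rewrite set_itv_ge ?integral_set0// bnd_simp -ltNge.
Qed.

Lemma ae_oppr (P : R -> Prop) :
  {ae mu, forall x, P x} -> {ae mu, forall x, P (- x)}.
Proof.
move=> [N [mN N0 PN]]; exists (-%R @^-1` N); split.
- by rewrite -[X in measurable X]setTI; exact: (@oppr_measurable R setT).
- by rewrite -N0; exact: lebesgue_measureN.
- by move=> x /= Px; exact: PN.
Qed.

End density_uniqueness.

(** * The density obtained from the kernel *)

Section density.
Context {R : realType} d (T : measurableType d) (P : probability T R)
  (X : 'I_2 * 'I_2 -> {RV P >-> R}).
Implicit Types (x y s t : R).
Local Notation mu := (@lebesgue_measure R).

Lemma expected_num_eigenvalues s t : uniform_entries X ->
  ('E_P[fun w => ((num_eigenvalues (random_mx X w) s t)%:R : R)%R] =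
   \int[mu]_(x in `[s, t]) (8^-1%:E * kappa_square x))%E.
Proof.
move=> hX; rewrite unlock -integral_entries_nroots.
rewrite -(ge0_expectation_entries hX (measurable_entries_nroots s t)
  (@entries_nroots_ge0 R s t)).
by apply: eq_integral => w _; rewrite num_eigenvaluesE !mxE.
Qed.

(** There are at most two eigenvalues. The finiteness is what the uniqueness argument requires. *)
Lemma expected_num_eigenvalues_fin_num s t :
  ('E_P[fun w => ((num_eigenvalues (random_mx X w) s t)%:R : R)%R])%E \is a
    fin_num.
Proof.
rewrite unlock; pose f w := nroots ((X (0, 0) w + X (1, 1) w) / 2)
  (((X (0, 0) w - X (1, 1) w) / 2) ^+ 2 + X (0, 1) w * X (1, 0) w) s t.
have mX ij : measurable_fun setT (X ij) by exact: measurable_funP.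
have mf : measurable_fun setT f.
  apply: measurable_nroots; first by apply: measurable_funM => //;
    exact: measurable_funD.
  apply: measurable_funD; last exact: measurable_funM.
  by apply: measurable_funX; apply: measurable_funM => //;
    exact: measurable_funB.
have f0 w : (0 <= (f w)%:E)%E by rewrite lee_fin nroots_ge0.
have f2 w : ((f w)%:E <= 2%:E)%E.
  rewrite lee_fin /f /nroots -natrD ler_nat.
  by case: (_ && _); case: (_ && _).
rewrite (eq_integral (fun w => (f w)%:E)); last first.
  by move=> w _; rewrite num_eigenvaluesE !mxE.
have I0 : (0 <= \int[P]_w (f w)%:E)%E by exact: integral_ge0.
rewrite (ge0_fin_numE I0).
have : (\int[P]_w (f w)%:E <= \int[P]_w (cst 2%:E) w)%E.
  by apply: ge0_le_integral => //; exact/measurable_EFinP.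
move/le_lt_trans; apply.
rewrite integral_cst//; apply: lte_mul_pinfty => //.
exact: le_lt_trans (probability_le1 P measurableT) (ltry 1).
Qed.

(** [fine] makes the extended-real value real; off the breakpoints that value is finite and nothing
    is lost. *)
Definition kappa_density x : R := fine (8^-1%:E * kappa_square x)%E.

Lemma kappa_densityE x : x \notin breakpoints ->
  (8^-1%:E * kappa_square x)%E = (kappa_density x)%:E /\
  kappa_density x = W_formula `|x|.
Proof.
move=> /kappa_squareE kE; rewrite /kappa_density kE -EFinM; split => //=.
by rewrite mulrA mulVf ?mul1r.
Qed.

Lemma kappa_densityN x : kappa_density (- x) = kappa_density x.
Proof. by rewrite /kappa_density kappa_squareN. Qed.

Lemma measurable_kappa_density : measurable_fun setT kappa_density.
Proof.
apply: (measurableT_comp (@fine_measurable R setT measurableT)).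
by apply: emeasurable_funM => //; exact: measurable_kappa_square.
Qed.

Lemma kappa_density_ge0 x : 0 <= kappa_density x.
Proof. by rewrite fine_ge0// mule_ge0// kappa_rect_ge0. Qed.

Lemma eigenvalue_density_kappa : uniform_entries X ->
  eigenvalue_density X kappa_density.
Proof.
move=> hX; split; first exact: measurable_kappa_density.
move=> s t st; rewrite expected_num_eigenvalues//.
apply: ge0_ae_eq_integral => //.
- apply: measurable_funTS; apply: emeasurable_funM => //.
  exact: measurable_kappa_square.
- by apply: measurable_funTS; apply/measurable_EFinP;
    exact: measurable_kappa_density.
- by move=> x _; rewrite mule_ge0// kappa_rect_ge0.
- by move=> x _; rewrite lee_fin kappa_density_ge0.
apply: (@ae_eq_finite _ _ breakpoints).
  exact: lebesgue_measure_set1.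
by move=> x /kappa_densityE[].
Qed.

End density.

Theorem theorem3 (R : realType) (d : measure_display) (T : measurableType d)
    (P : probability T R) (X : 'I_2 * 'I_2 -> {RV P >-> R})
    (hX : uniform_entries X) :
  (exists W : R -> R, eigenvalue_density X W) /\
  (forall W : R -> R, eigenvalue_density X W ->
    {ae (@lebesgue_measure R), forall x : R, W (- x) = W x} /\
    {ae (@lebesgue_measure R), forall x : R, 0 <= x -> W x = W_formula x}).
Proof.
have dens := eigenvalue_density_kappa hX.
split; first by exists (@kappa_density R).
move=> W [mW WE].
(* Any density has the same integrals over intervals as [kappa_density]; both claims are thereby
   transferred to that function. *)
have ae_W : {ae @lebesgue_measure R, forall x, W x = kappa_density x}.
  apply: ae_eq_integral_itv => //; first exact: measurable_kappa_density.
  - by move=> s t st; rewrite -(dens.2 _ _ st) expected_num_eigenvalues_fin_num.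
  - by move=> s t st; rewrite -WE// -(dens.2 _ _ st).
split.
  apply: filterS2 ae_W (ae_oppr ae_W).
    exact: (ae_filter_ringOfSetsType (@lebesgue_measure R)).
  by move=> x -> ->; exact: kappa_densityN.
have ae_f : {ae @lebesgue_measure R, forall x, setT x ->
    (kappa_density x)%:E = (W_formula `|x|)%:E}.
  apply: (@ae_eq_finite _ _ breakpoints).
    exact: lebesgue_measure_set1.
  by move=> x /kappa_densityE[_ ->].
apply: filterS2 ae_W ae_f.
  exact: (ae_filter_ringOfSetsType (@lebesgue_measure R)).
move=> x -> /(_ I)[->] x0.
by rewrite ger0_norm.
Qed.
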